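(* There exists an absolute constant $c>0$ such that the following holds. Let $k\ge 1$ and $\Delta\ge 0$ be integers. There is a constant $C=C(k,\Delta)<\infty$ such that for every $n\ge 2$ and every $n$-vertex $k$-uniform hypergraph $G$ with maximal degree $\Delta$, the (discrete-time) Glauber dynamics on the independent sets of $G$ has mixing time $t_{\mathrm{mix}}\le C\, n\log n$, provided that at least one of the following conditions holds: 1. $\Delta \le c\,2^{k/2}$; 2. $\Delta \le c\,2^{k}/k^2$ and $G$ is linear.
   Context: A hypergraph consists of a finite vertex set $V$ and a collection $F$ of subsets of $V$ (hyperedges); it is $k$-uniform (edge size $k$) if every hyperedge has exactly $k$ vertices. The degree of a vertex is the number of hyperedges containing it, and the maximal degree is the maximum over all vertices. The hypergraph is linear if no two distinct hyperedges share more than one vertex. An independent set is identified with a configuration $\sigma\in\{0,1\}^V$ such that every hyperedge $a\in F$ contains a vertex $v$ with $\sigma(v)=0$. Let $\Omega$ be the set of all such configurations and $\pi$ the uniform measure on $\Omega$. The (discrete-time) Glauber dynamics $(W_t)_{t\ge 0}$ is the Markov chain on $\Omega$ defined as follows. Given $W_t=\sigma$, choose $v\in V$ uniformly at random. With probability $1/2$, set $W_{t+1}=\sigma^{v,0}$; with the remaining probability $1/2$, set $W_{t+1}=\sigma^{v,1}$ if $\sigma^{v,1}\in\Omega$ and $W_{t+1}=\sigma$ otherwise. Here $\sigma^{v,x}$ is the configuration equal to $x$ at $v$ and equal to $\sigma$ elsewhere. Its stationary distribution is $\pi$. The mixing time is $$t_{\mathrm{mix}}=\inf\Big\{t:\max_{\sigma\in\Omega}\|\mathbb{P}(W_t=\cdot\mid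 W_0=\sigma)-\pi\|_{\mathrm{TV}}<\tfrac14\Big\},$$ where $\|\mu-\nu\|_{\mathrm{TV}}=\frac12\sum_{\sigma\in\Omega}|\mu(\sigma)-\nu(\sigma)|$. *)

(* Defs.v *)
From HB Require Import structures.
From mathcomp Require Import all_boot all_order all_algebra.
From mathcomp Require Import all_classical all_reals all_analysis.

Set Implicit Arguments.
Unset Strict Implicit.
Unset Printing Implicit Defensive.

Import Order.TTheory GRing.Theory Num.Theory.

Local Open Scope ring_scope.
Local Open Scope classical_set_scope.

Section Hypergraph.
Variables (V : finType) (F : {set {set V}}).

Definition uniform_hypergraph (k : nat) : bool :=
  [forall a : {set V}, (a \in F) ==> (#|a| == k)].

Definition degree (v : V) : nat := #|[set a in F | v \in a]|.

Definition max_degree : nat := (\max_(v : V) degree v)%N.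

Definition linear_hypergraph : bool :=
  [forall a : {set V}, forall b : {set V},
    [&& a \in F, b \in F & a != b] ==> (#|a :&: b| <= 1)%N].

Definition config : finType := {ffun V -> bool}.

Definition indep (sigma : config) : bool :=
  [forall a : {set V}, (a \in F) ==> [exists v : V, (v \in a) && ~~ sigma v]].

Definition Omega : {set config} := [set sigma | indep sigma]%SET.

Definition update (sigma : config) (v : V) (x : bool) : config :=
  [ffun w => if w == v then x else sigma w].

Variable R : realType.

Definition unif_indep (sigma : config) : R :=
  if sigma \in Omega then #|Omega|%:R^-1 else 0.

Definition glauber_kernel (sigma tau : config) : R :=
  \sum_(v : V) #|V|%:R^-1 *
    (2^-1 * (tau == update sigma v false)%:R
     + 2^-1 * (tau == if update sigma v true \in Omega
                      then update sigma v true else sigma)%:R).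

(* glauber_law t sigma tau = P(W_t = tau | W_0 = sigma). *)
Fixpoint glauber_law (t : nat) (sigma tau : config) : R :=
  if t is t'.+1 then
    \sum_(rho in Omega) glauber_law t' sigma rho * glauber_kernel rho tau
  else (tau == sigma)%:R.

Definition tv_dist (mu nu : config -> R) : R :=
  2^-1 * \sum_(sigma in Omega) `|mu sigma - nu sigma|.

(* The default value 0 of the maximum is harmless, since distances are
   nonnegative. *)
Definition worst_tv_dist (t : nat) : R :=
  \big[Num.max/0]_(sigma in Omega) tv_dist (glauber_law t sigma) unif_indep.

(* Extended-real valued, so that the infimum of the empty set is +oo. *)
Definition mixing_time : \bar R :=
  ereal_inf [set (t%:R)%:E | t in [set t : nat | worst_tv_dist t < 4^-1]].

End Hypergraph.

(* Main.v *)
Require Import Defs.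
From HB Require Import structures.
From mathcomp Require Import all_boot all_order all_algebra.
From mathcomp Require Import all_classical all_reals all_analysis.
From mathcomp Require Import fintype finset.
From mathcomp Require Import zify ring lra.

Set Implicit Arguments.
Unset Strict Implicit.
Unset Printing Implicit Defensive.

Import Order.TTheory GRing.Theory Num.Theory.

(** Run the dynamics from two independent sets with the same updates, an update
    being a vertex and a bit.  Suppose that the two copies still disagree.  A
    vertex c can only acquire a disagreement at an update with bit 1, when some
    edge A containing c is blocked in exactly one copy; then the most recent
    bit of every vertex of A is 1, and another vertex of A disagrees already.
    Going back in time, this yields a chain of edges A_0, A_1, ... at times
    tau_0 > tau_1 > ..., all of whose most recent bits are 1, such that the
    vertex c_{j+1} updated at tau_{j+1} lies in A_j and is idle until tau_j
    (disagree_chain).  Such chains must be shown to be rare by a first-moment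
    bound.

    The bits that two members of the chain rely on are independent unless both
    see the same update of a common vertex; common i j is the set of these
    vertices.  Walk from the end of the chain towards its beginning, always to
    the first member that shares an update with the present one.
    Non-consecutive members of the resulting sequence share nothing, so if
    consecutive members share o_i updates then o_i + o_{i+1} <= k, and m edges
    rely on about m k / 2 bits.  Each step thus has probability about
    2^(-k/2), against Delta choices for the next edge; this is the threshold
    of the first regime up to powers of k, which come from the choice of the
    time of an edge (it is an update time of one of its k vertices) and of the
    vertex where two edges meet.  Summed carefully these powers of k cancel
    (overlap_tradeoff), with one exception: members p < l < j follow each other
    in the sequence, A_l shares fewer than k/4 updates with A_p, and the vertex
    c_l, whose update at tau_l is not shared with A_p, lies in A_j too.  If A_l
    and A_j share at most k/2 updates, then there is an exponential gain to pay
    for the powers of k.  If they share more, A_l is dropped from the sequence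
    and A_j is linked through c_l to A_{l-1}, which contains c_l
    (placed_detour).  A later member whose first meeting is with A_j shares
    nothing with A_l, hence at most k/2 updates with A_j, and this pays for
    the detour.  In a linear hypergraph two different edges share at most one
    update, and the crude count k^2 Delta 2^(-k) of continuations through
    another edge is already small; there the only overlaps of more than one
    vertex come from using the same edge twice (linear_supersolution).

    The first-moment bound is one induction over the updates, read from the
    latest to the earliest (explores).  The set Z collects the vertices whose
    next update to be read is forced to carry the bit 1.  The probability that
    the exploration survives is at most a constant times 2^(-#|Z|) times a
    potential of its state, times 1 - lambda / n per update (bounded_step): the factor
    2^(-#|Z|) accounts exactly for the revealed bits, and the potential has to
    be a supersolution of a recursion on sets of vertices.  Hence the two
    copies differ after 2 m updates with probability at most
    n A (1 - lambda / n)^m, where A depends on k and Delta only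
    (coalescence_rate), and m of order n log n suffices.  The uniform measure
    is stationary because the kernel is symmetric, so coalescence bounds the
    distance to it (tv_dist_le). *)

(** * Update histories *)

Section UpdateHistories.
Variable V : finType.
Implicit Types (w u v : V) (Z A : {set V}) (L : seq (V * bool)).

Fixpoint hist (x : nat -> V * bool) (t : nat) : seq (V * bool) :=
  if t is t'.+1 then x t' :: hist x t' else [::].

(** The value [true] for a vertex without update makes this an upper bound of
    the configuration whatever the starting point (glauber_run_latest). *)
Fixpoint latest_bit w L : bool :=
  if L is y :: L' then if y.1 == w then y.2 else latest_bit w L' else true.

(** This asks in addition that every vertex of Z is updated, so that its
    probability is at most 2^(-#|Z|) with no correction for idle vertices. *)
Fixpoint all_latest_one L Z : bool :=
  if L is y :: L' then ((y.1 \in Z) ==> y.2) && all_latest_one L' (Z :\ y.1)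
  else Z == set0.

Lemma all_latest_oneP L Z :
  (forall w, w \in Z -> latest_bit w L /\ w \in map fst L) ->
  all_latest_one L Z.
Proof.
elim: L Z => [|[v b] L IH] Z /= H.
  by apply/eqP/setP => w; rewrite inE; apply/negP => /H [].
apply/andP; split.
  by apply/implyP => /H [] /=; rewrite eqxx.
apply: IH => w; rewrite !inE => /andP[wv /H[]].
by rewrite inE eq_sym (negbTE wv).
Qed.

Section Times.
Variable x : nat -> V * bool.

Definition idle (s t : nat) w : bool :=
  [forall i : 'I_t, (s <= i)%N ==> ((x i).1 != w)].

Lemma idleP s t w :
  reflect (forall i, (s <= i < t)%N -> (x i).1 != w) (idle s t w).
Proof.
apply: (iffP forallP) => H i.
  by case/andP => si it; have /implyP := H (Ordinal it); apply.
by apply/implyP => si; apply: H; rewrite si ltn_ord.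
Qed.

Lemma idleS s t w : (s <= t)%N ->
  idle s t.+1 w = ((x t).1 != w) && idle s t w.
Proof.
move=> st; apply/idleP/andP.
  move=> H; split; first by apply: H; rewrite st ltnSn.
  by apply/idleP => i /andP[si it]; apply: H; rewrite si ltnS ltnW.
case=> xt /idleP H i /andP[si]; rewrite ltnS leq_eqVlt => /orP[/eqP->//|it].
by apply: H; rewrite si.
Qed.

Lemma idle_nn s w : idle s s w.
Proof. by apply/idleP => i; lia. Qed.

Lemma idle_cat s t t2 w : idle s t w -> idle t t2 w -> idle s t2 w.
Proof.
move=> /idleP H1 /idleP H2; apply/idleP => i /andP[si iu].
by case: (ltnP i t) => it; [apply: H1; rewrite si | apply: H2; rewrite it].
Qed.

Lemma idle_sub s s' t t' w : (s <= s')%N -> (t' <= t)%N ->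
  idle s t w -> idle s' t' w.
Proof. by move=> ss tt /idleP H; apply/idleP => i hi; apply: H; lia. Qed.

Lemma latest_bit_idle s t w : (s <= t)%N -> idle s t w ->
  latest_bit w (hist x t) = latest_bit w (hist x s).
Proof.
elim: t => [|t IH]; first by rewrite leqn0 => /eqP->.
rewrite leq_eqVlt => /orP[/eqP->//|]; rewrite ltnS => st.
by rewrite idleS // => /andP[/negbTE /= -> /(IH st)].
Qed.

Definition surviving (s t : nat) A : {set V} := [set w in A | idle s t w].

Lemma survivingS s t A : (s <= t)%N ->
  surviving s t.+1 A = surviving s t (A :\ (x t).1).
Proof.
by move=> st; apply/setP => w; rewrite !inE idleS // eq_sym; do !case: (_ \in _) => //=; case: eqP => //=; rewrite ?andbF.
Qed.

Lemma surviving_nn s A : surviving s s A = A.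
Proof. by apply/setP => w; rewrite !inE idle_nn andbT. Qed.

End Times.
End UpdateHistories.

(** * Exploration of the update history *)

Section Exploration.
Variables (V : finType) (F : {set {set V}}) (k theta : nat).
Implicit Types (w u v : V) (Z A B Q : {set V}) (L : seq (V * bool)).

(** What the exploration expects next, after having placed an edge:
    - [Overlap A Q]: the next edge is A, and Q is the set of vertices of A shared
      with the last placed edge that have not been updated since;
    - [Witness w A]: the same, keeping only one shared vertex w; this loses a
      factor k and is used where at most k/2 updates are shared;
    - [Detour c w A]: wait for the update of c, a vertex of the last placed edge
      and of A, and then pass to [DetourWitness w A];
    - [DetourWitness w A]: place A, disjoint from everything placed, before w is
      updated;
    - [Survivor u]: u is not updated any more in the time window. *)
Inductive state :=
| Overlap of {set V} & {set V}
| Witness of V & {set V}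
| Detour of V & V & {set V}
| DetourWitness of V & {set V}
| Survivor of V.

(** The states allowed after placing A at an update of v, where Q is the overlap
    of A with the placed edges.  The vertices of A are then added to Z.  An
    [Overlap] state is refused in the two situations whose count would cost a
    power of k: after a detour, and when Q is small and v in B but not in Q.
    With [theta = 0] only [Overlap] and [Survivor] occur. *)
Definition successor (G : {set V} -> state -> bool) Z A v Q (full : bool) :=
  let Z' := (Z :|: A) :\ v in
  [|| [exists u in A, G Z' (Survivor u)],
      [exists B in F,
        [&& full, (theta <= #|Q|)%N || (v \notin B :\: Q),
            (A :&: B) :\: (v |: Q) != set0 &
            G Z' (Overlap B ((A :&: B) :\: (v |: Q)))]],
      (#|Q| < theta)%N &&
        [exists B in F, exists w in A :&: B, G Z' (Witness w B)] |
      (0 < theta)%N &&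
        [exists B in F, exists c in A :&: B, exists w in B,
           G Z' (Detour c w B)]].

(** Z collects the vertices of placed edges that have not been updated since the
    placement, so [A :&: Z] consists of the vertices of A whose latest update
    is shared with a placed edge: these provide no new bit. *)
Fixpoint explores (m : nat) L Z (st : state) : bool :=
  if m is m'.+1 then
    if L is y :: L' then
      let: v := y.1 in
      let G := explores m' L' in
      ((v \in Z) ==> y.2) &&
      match st with
      | Overlap A Q =>
          ((Q :\ v != set0) && G (Z :\ v) (Overlap A (Q :\ v)))
          || [&& v \in A, y.2, A :&: Z == Q & successor G Z A v Q true]
      | Witness w A =>
          ((v != w) && G (Z :\ v) st)
          || [&& v \in A, y.2, (2 * #|A :&: Z| <= k)%N &
                 successor G Z A v (A :&: Z) true]
      | Detour c w A =>
          if v == c then G (Z :\ v) (DetourWitness w A) else G (Z :\ v) st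
      | DetourWitness w A =>
          ((v != w) && G (Z :\ v) st)
          || [&& v \in A, y.2, A :&: Z == set0 & successor G Z A v set0 false]
      | Survivor u => (v != u) && G (Z :\ v) st
      end
    else false
  else all_latest_one L Z.

Section Deterministic.
Variable x : nat -> V * bool.
Local Notation hist := (hist x).
Local Notation idle := (idle x).
Local Notation surviving := (surviving x).

Definition state_surviving s t (st : state) : state :=
  if st is Overlap A Q then Overlap A (surviving s t Q) else st.

Definition state_alive s t (st : state) : bool :=
  match st with
  | Overlap A Q => surviving s t Q != set0
  | Witness w _ | Detour w _ _ | DetourWitness w _ | Survivor w => idle s t w
  end.

(** No edge is placed in the time interval from s to T0 + m: the sets are merely
    purged of the vertices updated in between. *)
Lemma explores_wait T0 s m m' Z st :
  (s <= T0 + m)%N -> s = (T0 + m')%N ->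
  (forall w, w \in Z -> latest_bit w (hist (T0 + m))) ->
  state_alive s (T0 + m) st ->
  explores m' (hist s) (surviving s (T0 + m) Z) (state_surviving s (T0 + m) st) ->
  explores m (hist (T0 + m)) Z st.
Proof.
move=> + es; elim: m Z st => [|m IH] Z st.
  rewrite addn0 => sT onZ al.
  have {al} eT : s = T0 by lia.
  have -> : m' = 0%N by lia.
  rewrite eT surviving_nn; case: st => //= A Q.
rewrite addnS leq_eqVlt => /orP[/eqP e|].
  have -> : m' = m.+1 by lia.
  rewrite -e surviving_nn => onZ al.
  by case: st al => //= A Q; rewrite surviving_nn.
rewrite ltnS => sT onZ al.
rewrite survivingS // => H.
have onZ' w : w \in Z :\ (x (T0 + m)%N).1 -> latest_bit w (hist (T0 + m)%N).
  rewrite !inE => /andP[wv wZ]; have /= := onZ _ wZ.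
  by rewrite eq_sym (negbTE wv).
rewrite [explores _ _ _ _]/=; apply/andP; split.
  by apply/implyP => vZ; have := onZ _ vZ; rewrite /= eqxx.
case: st al H => [A Q|w A|c w A|w A|u] /=.
- rewrite survivingS // => al H; apply/orP; left; apply/andP; split.
    apply: contraNneq al => ->; apply/eqP/setP => w; by rewrite !inE.
  exact: IH.
- rewrite idleS // => /andP[vw al] H; rewrite vw /=.
  by rewrite IH.
- rewrite idleS // => /andP[vw al] H; rewrite (negbTE vw) /=.
  exact: IH.
- rewrite idleS // => /andP[vw al] H; rewrite vw /=.
  by rewrite IH.
- rewrite idleS // => /andP[vw al] H; rewrite vw /=.
  exact: IH.
Qed.

End Deterministic.
End Exploration.

(** * From chains of edges to explorations *)

Section Chain.
Variables (V : finType) (F : {set {set V}}) (k theta : nat).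
Variables (x : nat -> V * bool) (T0 M : nat).
Variables (A : nat -> {set V}) (tau : nat -> nat).
Implicit Types (w u v : V) (Z B Q : {set V}).
Local Notation hist := (hist x).
Local Notation idle := (idle x).
Local Notation surviving := (surviving x).
Local Notation explores := (explores F k theta).
Let c j := (x (tau j)).1.

Hypothesis unifF : forall B, B \in F -> #|B| = k.
Hypothesis AF : forall j, (j <= M)%N -> A j \in F.
Hypothesis cA : forall j, (j <= M)%N -> c j \in A j.
Hypothesis tauT0 : forall j, (j <= M)%N -> (T0 <= tau j)%N.
Hypothesis bit1 : forall j, (j <= M)%N -> (x (tau j)).2.
Hypothesis onA : forall j, (j <= M)%N ->
  forall w, w \in A j -> latest_bit w (hist (tau j).+1).
Hypothesis tau_dec : forall j, (j < M)%N -> (tau j.+1 < tau j)%N.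
Hypothesis cA_prev : forall j, (j < M)%N -> c j.+1 \in A j.
Hypothesis c_idle : forall j, (j < M)%N -> idle (tau j.+1).+1 (tau j).+1 (c j.+1).

(** For i < j, the edge A i at time tau i and the edge A j at the earlier time
    tau j see the same latest update exactly of these vertices. *)
Definition common i j : {set V} := surviving (tau j).+1 (tau i).+1 (A i :&: A j).

Lemma tau_lt i j : (i < j)%N -> (j <= M)%N -> (tau j < tau i)%N.
Proof.
elim: j => // j IH; rewrite ltnS leq_eqVlt => /orP[/eqP->|ij] jM.
  exact: tau_dec.
exact: ltn_trans (tau_dec jM) (IH ij (ltnW jM)).
Qed.

Lemma common_prev j : (j < M)%N -> c j.+1 \in common j j.+1.
Proof. by move=> jM; rewrite !inE cA_prev // cA // c_idle. Qed.

Variable goal : Prop.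

(** Member j of the chain can be reached by an exploration that has placed only
    earlier members.  Reaching is expressed by its consequence for an arbitrary
    [goal], so that no exploration prefix has to be represented.  The flag [full]
    is false for an edge placed after a detour; it then overlaps some dropped
    member of the chain in more than half of its vertices. *)
Definition placed j Z Q (full : bool) : Prop :=
  [/\ forall w, w \in Z -> w = c j \/
        exists2 i, (i < j)%N & (w \in A i) && idle (tau j).+1 (tau i).+1 w,
      Q \subset Z,
      j = 0%N -> c j \in Q,
      full = false -> [/\ Q = set0, (0 < theta)%N &
        exists2 i, (i < j)%N & (k < 2 * #|common i j|)%N] &
      successor F theta (explores (tau j - T0) (hist (tau j))) Z (A j) (c j) Q full
      -> goal].

Section Step.
Variables (l j : nat) (Z Q : {set V}) (full : bool).
Hypothesis pl : placed l Z Q full.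
Let Z' := (Z :|: A l) :\ c l.
Let Zj := surviving (tau j).+1 (tau l) Z'.

Lemma pending_origin w : w \in Z' ->
  exists2 i, (i <= l)%N & (w \in A i) && idle (tau l) (tau i).+1 w.
Proof.
case: pl => P1 _ _ _ _.
rewrite !inE => /andP[wc /orP[/P1 [e|[i il /andP[wA wi]]]|wA]].
- by rewrite e eqxx in wc.
- exists i; first exact: ltnW.
  rewrite wA /=; apply/idleP => s /andP[s1 s2].
  move: s1; rewrite leq_eqVlt => /orP[/eqP<-|s1]; first by rewrite eq_sym.
  by move/idleP: wi; apply; rewrite s1.
- exists l => //; rewrite wA idleS // idle_nn andbT.
  by rewrite eq_sym.
Qed.

Lemma pending_on w : (l <= M)%N -> w \in Z' -> latest_bit w (hist (tau l)).
Proof.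
move=> lM /pending_origin[i il /andP[wA wi]].
rewrite -(latest_bit_idle _ wi); first by apply: onA wA; lia.
by move: il; rewrite leq_eqVlt => /orP[/eqP->//|il]; have := @tau_lt i l il; lia.
Qed.

Hypothesis lj : (l < j)%N.
Hypothesis jM : (j <= M)%N.

Lemma pendingj_origin w : w \in Zj ->
  exists2 i, (i <= l)%N & (w \in A i) && idle (tau j).+1 (tau i).+1 w.
Proof.
rewrite inE => /andP[/pending_origin[i il /andP[wA wi]] wj].
by exists i; rewrite // wA; apply: idle_cat wj wi.
Qed.

Lemma pendingj_placed w : w \in Zj -> w = c j \/
  exists2 i, (i < j)%N & (w \in A i) && idle (tau j).+1 (tau i).+1 w.
Proof.
by move=> /pendingj_origin[i il H]; right; exists i => //; apply: leq_ltn_trans lj.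
Qed.

Lemma reach st : state_alive x (tau j).+1 (tau l) st ->
  explores (tau j - T0).+1 (hist (tau j).+1) Zj
    (state_surviving x (tau j).+1 (tau l) st) ->
  explores (tau l - T0) (hist (tau l)) Z' st.
Proof.
have jl := tau_lt lj jM; have Tj := tauT0 jM.
have e : (T0 + (tau l - T0))%N = tau l by lia.
move=> al H; rewrite -[X in hist X]e.
apply: (@explores_wait _ _ _ _ _ T0 (tau j).+1 _ (tau j - T0).+1); rewrite ?e //; try lia.
move=> w; apply: pending_on; lia.
Qed.

Hypothesis fst_l : forall i, (i < l)%N -> common i j = set0.

(** As l is the first member meeting j, only the updates seen by A l can be
    shared with A j among those of all placed edges. *)
Lemma meet_pending : A j :&: Zj \subset common l j.
Proof.
apply/subsetP => w; rewrite in_setI => /andP[wAj /pendingj_origin[i il /andP[wAi wi]]].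
move: il; rewrite leq_eqVlt => /orP[/eqP e|il].
  by rewrite !inE -e wAi wAj wi.
have : w \in common i j by rewrite !inE wAi wAj wi.
by rewrite fst_l // inE.
Qed.

Lemma common_pending : common l j \subset A j :&: Zj.
Proof.
apply/subsetP => w; rewrite !inE => /andP[/andP[-> ->]].
have := tau_lt lj jM => jl.
rewrite idleS // => /andP[wc ->].
by rewrite /= orbT !andbT eq_sym.
Qed.

Lemma common_notQ w : w \in common l j -> w \notin Q.
Proof.
case: pl => P1 /subsetP QZ _ _ _.
rewrite !inE => /andP[/andP[wl wj] wi]; apply/negP => /QZ /P1 [e|[i il /andP[wAi wi']]].
  move/idleP: wi => /(_ (tau l)); rewrite e eqxx => H.
  by have := tau_lt lj jM => jl; have := H _; rewrite jl ltnSn => /(_ isT).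
have : w \in common i j by rewrite !inE wAi wj /=; apply: idle_cat wi wi'.
by rewrite fst_l // inE.
Qed.

Hypothesis meets : common l j != set0.

Lemma placed_overlap :
  full -> (theta <= #|Q|)%N || (c l \notin A j :\: Q) ->
  placed j Zj (A j :&: Zj) true.
Proof.
move=> fT okN; case: (pl) => P1 P3 P5 P6 P2; split.
- exact: pendingj_placed.
- exact: subsetIr.
- by move=> j0; move: lj; rewrite j0.
- by [].
move=> H; apply: P2; rewrite /successor; apply/or4P; constructor 2.
apply/existsP; exists (A j); rewrite AF //= fT /= okN /=.
have eJ : surviving (tau j).+1 (tau l) ((A l :&: A j) :\: (c l |: Q)) = A j :&: Zj.
  apply/eqP; rewrite eqEsubset; apply/andP; split.
    apply/subsetP => w; rewrite !inE => /andP[/andP[/norP[wc wQ] /andP[wl wj]] wi].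
    by rewrite wj wc wl orbT wi.
  apply/subsetP => w /(subsetP meet_pending) wC.
  have wQ := common_notQ wC.
  move: wC; rewrite !inE (negbTE wQ) orbF => /andP[/andP[-> ->]].
  rewrite idleS; last by have := tau_lt lj jM; lia.
  by rewrite eq_sym => /andP[-> ->].
have mZ : A j :&: Zj != set0.
  by apply: contraNneq meets => e; rewrite -subset0 -e common_pending.
apply/andP; split.
  apply: contraNneq mZ => e; rewrite -eJ e; apply/eqP/setP => w; by rewrite !inE.
apply: reach => /=; rewrite eJ //.
apply/andP; split.
  apply/implyP => _; exact: bit1.
apply/orP; right; rewrite cA // bit1 //= eqxx /=.
exact: H.
Qed.

Lemma placed_witness :
  (#|Q| < theta)%N -> (2 * #|common l j| <= k)%N ->
  placed j Zj (A j :&: Zj) true.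
Proof.
move=> Qt small; case: (pl) => P1 P3 P5 P6 P2; split.
- exact: pendingj_placed.
- exact: subsetIr.
- by move=> j0; move: lj; rewrite j0.
- by [].
move=> H; apply: P2; rewrite /successor; apply/or4P; constructor 3.
rewrite Qt; apply/existsP; exists (A j); rewrite AF //=.
have /set0Pn[w wC] := meets.
apply/existsP; exists w.
have : w \in common l j by [].
rewrite !inE => /andP[-> ]; rewrite idleS; last by have := tau_lt lj jM; lia.
move=> /andP[_ wi]; apply: reach => //=.
apply/andP; split.
  apply/implyP => _; exact: bit1.
apply/orP; right; rewrite cA // bit1 //=.
rewrite (leq_trans _ small) ?leq_mul2l ?subset_leq_card ?meet_pending //=.
Qed.

End Step.

(** Here member l.+1 is skipped.  Its update vertex c l.+1 lies in A l and in A j,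
    and a vertex of [common l.+1 j] is idle between the two times, which bounds
    the waiting time of the detour. *)
Lemma placed_detour l j Z Q full :
  (l.+1 < j)%N -> (j <= M)%N -> placed l Z Q full -> (0 < theta)%N ->
  (forall i, (i <= l)%N -> common i j = set0) ->
  c l.+1 \in A j -> (k < 2 * #|common l.+1 j|)%N ->
  placed j (surviving (tau j).+1 (tau l) ((Z :|: A l) :\ c l)) set0 false.
Proof.
move=> lj jM pl th fst_l cj big; have lj' : (l < j)%N by lia.
have lM : (l < M)%N by lia.
split.
- exact: pendingj_placed pl lj'.
- exact: sub0set.
- by move=> j0; move: lj; rewrite j0.
- by move=> _; split=> //; exists l.+1.
case: (pl) => _ _ _ _ P2.
move=> H; apply: P2; rewrite /successor; apply/or4P; constructor 4.
rewrite th; apply/existsP; exists (A j); rewrite AF //=.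
apply/existsP; exists (c l.+1); rewrite inE cA_prev //= cj /=.
have : common l.+1 j != set0 by apply: contraTneq big => ->; rewrite cards0.
case/set0Pn => w wC; apply/existsP; exists w.
move: (wC); rewrite !inE => /andP[/andP[wl wj] wi]; rewrite wj /=.
have lt1 := tau_lt (ltnSn l) lM; have lt2 := tau_lt lj jM.
move: wi; rewrite idleS // => /andP[wc wi].
have ci := c_idle lM; rewrite idleS // in ci; case/andP: ci => cc ci.
apply: (reach (l := l) (j := l.+1)) => //=; first exact: pl.
apply/andP; split; first by apply/implyP => _; exact: bit1.
rewrite eqxx.
set Z1 := _ :\ _.
have Tj := tauT0 jM.
have e : (T0 + (tau l.+1 - T0))%N = tau l.+1 by lia.
rewrite -[X in hist X]e.
apply: (@explores_wait _ _ _ _ _ T0 (tau j).+1 _ (tau j - T0).+1); rewrite ?e; try lia.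
- move=> u; rewrite !inE => /andP[uc /andP[/andP[ul uZ] ui]].
  have /(pending_on pl (ltnW lM)) : u \in (Z :|: A l) :\ c l by rewrite !inE ul.
  rewrite (latest_bit_idle _ ui) //= .
  by rewrite eq_sym (negbTE uc).
- exact: wi.
have eZ : surviving (tau j).+1 (tau l.+1) Z1 =
          surviving (tau j).+1 (tau l) ((Z :|: A l) :\ c l).
  apply/setP => u; rewrite !inE.
  apply/idP/idP.
    case/andP => /andP[uc /andP[/andP[-> ->] ui]] ui'; rewrite /=.
    apply: (@idle_cat _ _ _ (tau l.+1).+1); last exact: ui.
    by rewrite idleS // ui' eq_sym uc.
  case/andP => /andP[-> ->] ui /=.
  have := idle_sub (leqnn _) lt1 ui; rewrite idleS // => /andP[uc ->].
  rewrite eq_sym uc /= andbT; apply: idle_sub ui => //; lia.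
rewrite eZ; set Zj := surviving _ _ _ in H *.
rewrite /=; apply/andP; split; first by apply/implyP => _; exact: bit1.
apply/orP; right; rewrite cA // bit1 //=.
have -> : A j :&: Zj == set0.
  rewrite -subset0; apply/subsetP => u; rewrite in_setI => /andP[uj].
  case/(pendingj_origin pl) => i il /andP[uA ui].
  have : u \in common i j by rewrite !inE uA uj ui.
  by rewrite fst_l.
exact: H.
Qed.

(** Strong induction on j, with l the first member that meets j.  If l was placed
    after a detour, then the dropped member before l has more than half of A l
    and nothing of A j in common, so that l and j share at most k/2 updates.  If
    l is dropped, the induction hypothesis is used for the member before it. *)
Lemma placed_exists j :
  (exists Z Q full, placed 0 Z Q full /\ full) -> (j <= M)%N ->
  exists Z Q full, placed j Z Q full.
Proof.
case=> Z0 [Q0 [f0 [pl0 f0T]]].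
have [n] := ubnP j; elim: n j => // n IH j jn jM.
case: j jn jM => [|j] jn jM; first by exists Z0, Q0, f0.
have ex : exists i, (i <= j)%N && (common i j.+1 != set0).
  by exists j; rewrite leqnn; apply/set0Pn; exists (c j.+1); exact: common_prev.
have [l [lj meets minl]] : exists l, [/\ (l <= j)%N, common l j.+1 != set0 &
   forall i, (i < l)%N -> common i j.+1 = set0].
  case: (ex_minnP ex) => m /andP[mj mm] mmin; exists m; split=> // i im.
  apply/eqP; apply: contraTT im => H; rewrite -leqNgt.
  case: (leqP i j) => ij; first by apply: mmin; rewrite ij.
  exact: leq_trans mj (ltnW ij).
have lM : (l <= M)%N by lia.
have [Z [Q [full pl]]] := IH l ltac:(lia) lM.
have lj1 : (l < j.+1)%N by [].
case fT : full pl => pl; last first.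
  case: (pl) => P1 P3 P5 /(_ erefl)[Q0_ th [i il big]] P2.
  have small : (2 * #|common l j.+1| <= k)%N.
    have dis : [disjoint common i l & common l j.+1].
      rewrite -setI_eq0 -subset0; apply/subsetP => w; rewrite !inE.
      move=> /andP[/andP[/andP[wi wl] w1] /andP[/andP[_ wj] w2]].
      have : w \in common i j.+1.
        by rewrite !inE wi wj /=; apply: idle_cat w2 w1.
      by rewrite minl // inE.
    have /subset_leq_card : common i l :|: common l j.+1 \subset A l.
      by apply/subsetP => w; rewrite !inE => /orP[] /andP[/andP[]].
    rewrite cardsU disjoint_setI0 // cards0 subn0 (unifF (AF lM)).
    by move: big; lia.
  exists (surviving (tau j.+1).+1 (tau l) ((Z :|: A l) :\ c l)); do 2!eexists.
  by apply: (placed_witness pl lj1 jM) => //; rewrite Q0_ cards0.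
case okN : ((theta <= #|Q|)%N || (c l \notin A j.+1 :\: Q)).
  do 3!eexists; exact: (placed_overlap pl lj1 jM).
move/negbT: okN; rewrite negb_or -ltnNge negbK => /andP[Qt].
rewrite inE => /andP[cQ cAj].
case: (leqP (2 * #|common l j.+1|) k) => small.
  do 3!eexists; exact: (placed_witness pl lj1 jM).
case: l lj meets minl lM pl lj1 Qt cQ cAj small => [|l] lj meets minl lM pl lj1 Qt cQ cAj small.
  by case: pl => _ _ /(_ erefl); rewrite (negbTE cQ).
have [Z' [Q' [full' pl']]] := IH l ltac:(lia) ltac:(lia).
do 3!eexists; apply: (placed_detour (l := l)) pl' _ _ _ _ => //; exact: leq_ltn_trans Qt.
Qed.

End Chain.

(** * Disagreements under the common-update coupling *)

Section Coupling.
Variables (V : finType) (F : {set {set V}}).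
Implicit Types (s r : config V) (w u v : V) (y : V * bool) (L : seq (V * bool)).

Definition glauber_step s y : config V :=
  if y.2 then
    if update s y.1 true \in Omega F then update s y.1 true else s
  else update s y.1 false.

Definition glauber_run s L : config V :=
  foldr (fun y r => glauber_step r y) s L.

Lemma OmegaP s :
  reflect (forall B, B \in F -> exists2 u, u \in B & ~~ s u) (s \in Omega F).
Proof.
rewrite inE; apply: (iffP forallP) => H B.
  move=> BF; have /implyP/(_ BF)/existsP[u /andP[uB su]] := H B; by exists u.
by apply/implyP => /H[u uB su]; apply/existsP; exists u; rewrite uB.
Qed.

Lemma glauber_step_Omega s y : s \in Omega F -> glauber_step s y \in Omega F.
Proof.
move=> sO; rewrite /glauber_step; case: ifP => _; first by case: ifP.
apply/OmegaP => B /(OmegaP _ sO)[u uB su]; exists u => //.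
by rewrite ffunE; case: eqP.
Qed.

Lemma glauber_run_Omega s L : s \in Omega F -> glauber_run s L \in Omega F.
Proof. by move=> sO; elim: L => //= y L; apply: glauber_step_Omega. Qed.

Lemma glauber_step_neq s y w : w != y.1 -> glauber_step s y w = s w.
Proof.
move=> wy; rewrite /glauber_step.
by do 2?case: ifP => _ //; rewrite ffunE (negbTE wy).
Qed.

Lemma glauber_step_at s y : s \in Omega F ->
  glauber_step s y y.1 = y.2 && (update s y.1 true \in Omega F).
Proof.
move=> sO; rewrite /glauber_step; case: ifP => //= b; last by rewrite ffunE eqxx.
case: ifP => H; first by rewrite ffunE eqxx.
apply/negP => sy; move/negP: H; apply; rewrite (_ : update _ _ _ = s) //.
by apply/ffunP => w; rewrite ffunE; case: eqP => // ->.
Qed.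

Lemma glauber_run_latest s L w : s \in Omega F ->
  glauber_run s L w -> latest_bit w L.
Proof.
move=> sO; elim: L => //= y L IH; case: eqP => [<-|/eqP yw].
  by rewrite glauber_step_at ?glauber_run_Omega // => /andP[].
by rewrite glauber_step_neq // eq_sym.
Qed.

Lemma one_sided_block s r v :
  update s v true \notin Omega F -> update r v true \in Omega F ->
  s \in Omega F ->
  exists B, [/\ B \in F, v \in B, forall w, w \in B -> w != v -> s w &
                exists u, [/\ u \in B, u != v & s u != r u]].
Proof.
rewrite inE negb_forall => /existsP[B]; rewrite negb_imply => /andP[BF].
rewrite negb_exists => /forallP H rO sO; exists B.
have sB w : w \in B -> w != v -> s w.
  move=> wB wv; have := H w; rewrite wB /= negbK ffunE (negbTE wv) //.
split=> //.
  have [u uB su] := OmegaP _ sO B BF; have := H u.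
  rewrite uB /= negbK ffunE; case: eqP => [<-|] // _; by rewrite (negbTE su).
have [u uB ru] := OmegaP _ rO B BF; exists u.
move: ru; rewrite ffunE; case: eqP => // /eqP uv ru; split=> //.
by rewrite sB // eq_sym; apply: contraNneq ru => ->.
Qed.

Section Chains.
Variables (s r : config V) (x : nat -> V * bool) (T0 : nat).
Hypotheses (sO : s \in Omega F) (rO : r \in Omega F).
Local Notation hist := (hist x).
Local Notation idle := (idle x).

Definition disagree t v := glauber_run s (hist t) v != glauber_run r (hist t) v.

(** Immediately before the update that created the disagreement at v, the edge B
    is all ones off v in one copy, hence its latest bits are 1, while the other
    copy has a zero in it. *)
Lemma disagree_origin t v : (T0 <= t)%N -> disagree t v ->
  idle T0 t v \/
  exists B tau, [/\ (T0 <= tau < t)%N, x tau = (v, true) /\ idle tau.+1 t v,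
    (B \in F) && (v \in B), forall w, w \in B -> latest_bit w (hist tau.+1) &
    exists u, [/\ u \in B, u != v & disagree tau u]].
Proof.
elim: t => [|t IH].
  by rewrite leqn0 => /eqP-> _; left; apply/idleP => i; lia.
rewrite leq_eqVlt => /orP[/eqP-> _|]; first by left; apply: idle_nn.
rewrite ltnS => Tt; rewrite /disagree /=.
case: (eqVneq v (x t).1) => [ev|vt]; last first.
  rewrite !glauber_step_neq // => /(IH Tt)[H|[B [tau [H1 [H2 H3] H4 H5 H6]]]].
    by left; rewrite idleS // eq_sym vt.
  right; exists B, tau; split=> //; first by lia.
  by split=> //; rewrite idleS ?(eq_sym _ v) ?vt //; lia.
set S := glauber_run s _; set R := glauber_run r _.
have SO : S \in Omega F by apply: glauber_run_Omega.
have RO : R \in Omega F by apply: glauber_run_Omega.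
rewrite ev !glauber_step_at //; case xb : (x t).2 => //=.
have ex : x t = (v, true) by rewrite ev -xb; case: (x t).
have onB B : (forall w, w \in B -> w != v -> S w) \/ (forall w, w \in B -> w != v -> R w) ->
    forall w, w \in B -> latest_bit w (hist t.+1).
  move=> H w wB /=; rewrite ex /=; case: eqP => // /eqP vw.
  case: H => /(_ w wB); rewrite eq_sym vw => /(_ isT); exact: glauber_run_latest.
rewrite -ev => neq.
have [B [BF vB H [u [uB uv Su]]]] : exists B, [/\ B \in F, v \in B,
    (forall w, w \in B -> w != v -> S w) \/ (forall w, w \in B -> w != v -> R w) &
    exists u, [/\ u \in B, u != v & S u != R u]].
  move: neq; case US : (_ \in _); case UR : (_ \in _) => // _.
    have [B [? ? ? [u [? ?]]]] := one_sided_block (negbT UR) US RO.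
    by rewrite eq_sym => ?; exists B; split=> //; [right|exists u].
  have [B [? ? ? ?]] := one_sided_block (negbT US) UR SO.
  by exists B; split=> //; left.
right; exists B, t; split=> //; first by rewrite Tt ltnSn.
- by split=> //; exact: idle_nn.
- by rewrite BF.
- exact: onB.
- by exists u.
Qed.

Lemma disagree_chain t v : (T0 <= t)%N -> disagree t v ->
  idle T0 t v \/
  exists M (A : nat -> {set V}) (tau : nat -> nat),
  let c j := (x (tau j)).1 in
  [/\ (tau 0%N < t)%N, c 0%N = v, idle (tau 0%N).+1 t v,
      forall j, (j <= M)%N -> [/\ A j \in F, c j \in A j, (T0 <= tau j)%N,
        (x (tau j)).2 & forall w, w \in A j -> latest_bit w (hist (tau j).+1)] &
      (forall j, (j < M)%N -> [/\ (tau j.+1 < tau j)%N, c j.+1 \in A j &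
         idle (tau j.+1).+1 (tau j).+1 (c j.+1)]) /\
      exists2 u, u \in A M & idle T0 (tau M).+1 u].
Proof.
have [n] := ubnP t; elim: n t v => // n IH t v tn Tt /(disagree_origin Tt)[|].
  by left.
case=> B [t1 [/andP[Tt1 t1t] [xt1 it1] /andP[BF vB] onB [u [uB uv du]]]]; right.
have uidle t2 : (t2 <= t1)%N -> idle t2 t1 u -> idle t2 t1.+1 u.
  by move=> le H; rewrite idleS // H xt1 /= eq_sym uv.
case: (IH t1 u _ Tt1 du); first by lia.
  move=> iu; exists 0%N, (fun=> B), (fun=> t1); split.
  - exact: t1t.
  - by rewrite /= xt1.
  - exact: it1.
  - by move=> j _; split=> //; rewrite xt1.
  - by split=> //; exists u => //; apply: uidle.
case=> M [A [tau [H1 H2 H3 H4 [H5 [u' H6 H7]]]]].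
exists M.+1, (fun j => if j is j'.+1 then A j' else B),
  (fun j => if j is j'.+1 then tau j' else t1); split.
- exact: t1t.
- by rewrite xt1.
- exact: it1.
- case=> [|j] jM; last exact: H4.
  by split=> //; rewrite xt1.
- split; last by exists u'.
  case=> [|j] jM; last exact: H5.
  by rewrite H2; split=> //; apply: uidle.
Qed.

Variables (k theta : nat).
Hypothesis unifF : forall B, B \in F -> #|B| = k.

(** The exploration starts with the target v alone as overlap: the first edge
    is placed at the latest update of v. *)
Lemma disagree_explores m v :
  (forall w, w \in map fst (hist T0)) -> disagree (T0 + m) v ->
  explores F k theta m (hist (T0 + m)) set0 (Survivor v) \/
  exists2 B, (B \in F) && (v \in B) &
    explores F k theta m (hist (T0 + m)) [set v] (Overlap B [set v]).
Proof.
move=> allup /disagree_chain[|iv|]; first exact: leq_addr.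
  left; apply: (@explores_wait _ _ _ _ _ T0 T0 _ 0) => //=; try lia.
    by move=> w; rewrite inE.
  by apply: all_latest_oneP => w; rewrite !inE.
case=> M [A [tau [t0 c0 i0 HA [Hd [u uA iu]]]]]; right; exists (A 0%N).
  by have [-> H _ _ _] := HA 0%N isT; rewrite -c0 H.
set goal := explores _ _ _ _ _ _ _.
have AF j : (j <= M)%N -> A j \in F by case/HA.
have cA j : (j <= M)%N -> (x (tau j)).1 \in A j by case/HA.
have tT j : (j <= M)%N -> (T0 <= tau j)%N by case/HA.
have b1 j : (j <= M)%N -> (x (tau j)).2 by case/HA.
have onA j : (j <= M)%N -> forall w, w \in A j -> latest_bit w (hist (tau j).+1) by case/HA.
have td j : (j < M)%N -> (tau j.+1 < tau j)%N by case/Hd.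
have cp j : (j < M)%N -> (x (tau j.+1)).1 \in A j by case/Hd.
have ci j : (j < M)%N -> idle (tau j.+1).+1 (tau j).+1 (x (tau j.+1)).1 by case/Hd.
have pl0 : placed F k theta x T0 A tau goal 0 [set v] [set v] true.
  split=> //.
  - by move=> w; rewrite inE => /eqP->; left.
  - by rewrite c0 inE.
  move=> H; have T00 := tT 0%N isT.
  have e : surviving x (tau 0%N).+1 (T0 + m) [set v] = [set v].
    apply/setP => w; rewrite !inE; case: eqP => // ->; by rewrite i0.
  apply: (@explores_wait _ _ _ _ _ T0 (tau 0%N).+1 _ (tau 0%N - T0).+1) => //; try lia.
  - move=> w; rewrite inE => /eqP->.
    rewrite (latest_bit_idle _ i0) //; apply: onA => //; by rewrite -c0 cA.
  - by rewrite /= e; apply/set0Pn; exists v; rewrite inE.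
  rewrite /= e; apply/andP; split; first by apply/implyP => _; exact: b1.
  apply/orP; right; rewrite cA // b1 //=; apply/andP; split=> //.
  apply/eqP/setP => w; rewrite !inE; case: eqP => [->|_]; rewrite ?andbF //.
  by rewrite -c0 cA.
have [Z [Q [full pl]]] := placed_exists unifF AF cA tT b1 onA td cp ci
   (ex_intro _ _ (ex_intro _ _ (ex_intro _ _ (conj pl0 isT)))) (leqnn M).
case: (pl) => _ _ _ _; apply; rewrite /successor; apply/or4P; constructor 1.
apply/existsP; exists u; rewrite uA /=.
have TM := tT M (leqnn M).
have e : (T0 + (tau M - T0))%N = tau M by lia.
rewrite -[X in hist X]e.
apply: (@explores_wait _ _ _ _ _ T0 T0 _ 0) => //; rewrite ?e; try lia.
- move=> w; exact: (pending_on onA td pl (leqnn M)).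
- by apply: idle_sub iu.
apply: all_latest_oneP => w; rewrite inE => /andP[wZ wi]; split=> //.
rewrite -(latest_bit_idle TM wi).
exact: (pending_on onA td pl (leqnn M)).
Qed.

End Chains.
End Coupling.

Local Open Scope ring_scope.

(** * Averages over update sequences *)

Section Expectation.
Variables (R : realFieldType) (V : finType).
Implicit Types (f g : seq (V * bool) -> R).

(** The outermost average is over the head of the list, which is the latest
    update, so that events defined by recursion on lists unfold along with it. *)
Fixpoint expect (n : nat) f : R :=
  if n is n'.+1 then
    (2 * #|V|%:R)^-1 *
      \sum_(v : V) (expect n' (fun L => f ((v, true) :: L)) +
                    expect n' (fun L => f ((v, false) :: L)))
  else f [::].

Lemma expect_le n f g :
  (forall L, size L = n -> f L <= g L) -> expect n f <= expect n g.
Proof.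
elim: n f g => [|n IH] f g H /=; first exact: H.
rewrite ler_wpM2l // ?invr_ge0 ?mulr_ge0 ?ler0n //.
by apply: ler_sum => v _; apply: lerD; apply: IH => L sL; apply: H; rewrite /= sL.
Qed.

Lemma expect_eq n f g :
  (forall L, size L = n -> f L = g L) -> expect n f = expect n g.
Proof. by move=> H; apply/eqP; rewrite eq_le !expect_le // => L /H ->. Qed.

Lemma expectD n f g : expect n (fun L => f L + g L) = expect n f + expect n g.
Proof.
elim: n f g => //= n IH f g; rewrite -mulrDr -big_split /=; congr (_ * _).
by apply: eq_bigr => v _; rewrite !IH addrACA.
Qed.

Lemma expect_mull n (c : R) f : expect n (fun L => c * f L) = c * expect n f.
Proof.
elim: n f => //= n IH f; rewrite mulrCA; congr (_ * _); rewrite mulr_sumr.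
by apply: eq_bigr => v _; rewrite !IH mulrDr.
Qed.

Lemma expect0 n : expect n (fun=> 0) = 0.
Proof.
by elim: n => //= n IH; rewrite IH big1 ?mulr0 // => v _; rewrite addr0.
Qed.

Lemma expect_sum n (I : finType) (P : pred I) (f : I -> seq (V * bool) -> R) :
  expect n (fun L => \sum_(i | P i) f i L) = \sum_(i | P i) expect n (f i).
Proof.
elim: n f => //= n IH f; rewrite -mulr_sumr; congr (_ * _).
rewrite exchange_big /=; apply: eq_bigr => v _.
by rewrite !IH -big_split.
Qed.

Lemma expect_ge0 n f : (forall L, 0 <= f L) -> 0 <= expect n f.
Proof. by move=> f0; rewrite -(expect0 n); apply: expect_le. Qed.

Hypothesis V0 : (0 < #|V|)%N.

Lemma expect_drop m n f : expect (m + n) (fun L => f (drop m L)) = expect n f.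
Proof.
elim: m => [|m IH] /=; first by apply: expect_eq => L _; rewrite drop0.
rewrite [X in _ * X](eq_bigr (fun=> expect n f + expect n f)) => [|v _]; last by rewrite !IH.
rewrite sumr_const cardT -cardE -mulr_natr.
have : (#|V|%:R : R) != 0 by rewrite pnatr_eq0 -lt0n.
by move=> nz; field.
Qed.

Lemma expect_not_updated n (w : V) :
  expect n (fun L => (w \notin map fst L)%:R) = (1 - #|V|%:R^-1) ^+ n.
Proof.
elim: n => [|n IH] /=; first by rewrite expr0.
have nz : (#|V|%:R : R) != 0 by rewrite pnatr_eq0 -lt0n.
rewrite (bigD1 w) //= [X in X + _](_ : _ = 0); last first.
  rewrite -[RHS](addr0 0); congr (_ + _); rewrite -[RHS](expect0 n);
    by apply: expect_eq => L _; rewrite inE eqxx.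
rewrite add0r (eq_bigr (fun=> 2 * (1 - #|V|%:R^-1) ^+ n)) => [|v vw]; last first.
  rewrite mulr_natl mulr2n -IH; congr (_ + _); apply: expect_eq => L _;
    by rewrite inE eq_sym (negbTE vw).
have e1 : (#|V|.-1%:R : R) = #|V|%:R - 1.
  by rewrite -[in RHS](prednK V0) -natr1 addrK.
rewrite sumr_const cardC1 -(mulr_natr _ #|V|.-1) e1 exprS.
by field.
Qed.

Section Booleans.
Lemma ler_bool_or (b1 b2 : bool) : ((b1 || b2)%:R : R) <= b1%:R + b2%:R.
Proof. by case: b1 b2 => [] [] /=; rewrite ?addr0 ?add0r // lerDl ler01. Qed.

Lemma ler_bool_exists (I : finType) (P b : pred I) :
  ([exists i in P, b i]%:R : R) <= \sum_(i in P) (b i)%:R.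
Proof.
case: existsP => [[i /andP[iP bi]]|_]; last by apply: sumr_ge0.
by rewrite (bigD1 i) //= bi lerDl sumr_ge0.
Qed.
End Booleans.

Lemma expect_or n (b1 b2 : seq (V * bool) -> bool) :
  expect n (fun L => (b1 L || b2 L)%:R) <=
  expect n (fun L => (b1 L)%:R) + expect n (fun L => (b2 L)%:R).
Proof. by rewrite -expectD; apply: expect_le => L _; exact: ler_bool_or. Qed.

Lemma expect_exists n (I : finType) (P : pred I) (b : I -> seq (V * bool) -> bool) :
  expect n (fun L => [exists i in P, b i L]%:R) <=
  \sum_(i in P) expect n (fun L => (b i L)%:R).
Proof.
by rewrite -expect_sum; apply: expect_le => L _; exact: ler_bool_exists.
Qed.

Lemma expect_and n (e : bool) (b : seq (V * bool) -> bool) :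
  expect n (fun L => (e && b L)%:R) = e%:R * expect n (fun L => (b L)%:R).
Proof.
case: e => /=; first by rewrite mul1r.
by rewrite mul0r expect0.
Qed.

End Expectation.

(** * Supersolutions bound the exploration probability *)

Section Potential.
Variables (R : realFieldType) (V : finType) (F : {set {set V}}) (k theta T0 : nat).
Implicit Types (Z A B Q : {set V}) (u v w : V) (L : seq (V * bool)).
Local Notation explores := (explores F k theta).

Variables (fO : nat -> R) (fW fD fDW fS lam : R).

Definition potential (st : state V) : R :=
  match st with
  | Overlap _ Q => fO #|Q|
  | Witness _ _ => fW
  | Detour _ _ _ => fD
  | DetourWitness _ _ => fDW
  | Survivor _ => fS
  end.

Definition successor_cost A v Q (full : bool) : R :=
  \sum_(u in A) fS
  + (full%:R * \sum_(B in F) ((theta <= #|Q|)%N || (v \notin B :\: Q))%:R *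
                    fO #|(A :&: B) :\: (v |: Q)|
  + ((#|Q| < theta)%N%:R * (\sum_(B in F) \sum_(w in A :&: B) fW)
  + (0 < theta)%N%:R * (\sum_(B in F) \sum_(c in A :&: B) \sum_(w in B) fD))).

Definition relevant (st : state V) : bool :=
  match st with
  | Overlap A Q => (A \in F) && (Q != set0)
  | Witness _ A | Detour _ _ A | DetourWitness _ A => (A \in F) && (0 < theta)%N
  | Survivor _ => true
  end.

(** Probability that the vertices of Z, once updated, all receive the bit 1. *)
Definition reveal_prob Z : R := 2^-1 ^+ #|Z|.

Hypothesis fO_ge0 : forall q, 0 <= fO q.
Hypotheses (fW_ge0 : 0 <= fW) (fD_ge0 : 0 <= fD) (fDW_ge0 : 0 <= fDW) (fS_ge0 : 0 <= fS).

Lemma reveal_prob_ge0 Z : 0 <= reveal_prob Z.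
Proof. by rewrite exprn_ge0 ?invr_ge0 ?ler0n. Qed.

(** N is the number of updates still to be read and m the number of them in the
    time window. *)
Definition bounded_at (N m : nat) (beta : R) : Prop :=
  forall Z st, relevant st ->
    expect N (fun L => (explores m L Z st)%:R) <= beta * reveal_prob Z * potential st.

Lemma expect_successor N m beta Z A v Q full : 0 <= beta -> bounded_at N m beta ->
  expect N (fun L => (successor F theta (explores m L) Z A v Q full)%:R) <=
  beta * reveal_prob ((Z :|: A) :\ v) * successor_cost A v Q full.
Proof.
move=> b0 H; set Z' := _ :\ v; set c := beta * _.
rewrite /successor /successor_cost.
have split3 (b1 b2 : seq (V * bool) -> bool) (x1 x2 : R) :
    expect N (fun L => (b1 L)%:R) <= c * x1 -> expect N (fun L => (b2 L)%:R) <= c * x2 ->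
    expect N (fun L => (b1 L || b2 L)%:R) <= c * (x1 + x2).
  by move=> h1 h2; apply: le_trans (expect_or _ _ _ _) _; rewrite mulrDr lerD.
apply: (split3); last apply: (split3); last apply: (split3).
- apply: le_trans (expect_exists _ _ _ _) _; rewrite mulr_sumr.
  by apply: ler_sum => u _; apply: H.
- apply: le_trans (expect_exists _ _ _ _) _; rewrite !mulr_sumr.
  apply: ler_sum => B BF; rewrite expect_and.
  rewrite [leRHS]mulrCA ler_wpM2l ?ler0n //.
  rewrite expect_and [leRHS]mulrCA ler_wpM2l ?ler0n //.
  rewrite expect_and; set J := _ :\: _; case J0: (J != set0); last first.
    by rewrite mul0r !mulr_ge0 ?reveal_prob_ge0.
  by rewrite mul1r; apply: (H Z' (Overlap B J)); rewrite /= BF.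
- rewrite expect_and [leRHS]mulrCA; case: ltnP => [Qt|]; last by rewrite !mul0r.
  rewrite ler_wpM2l ?ler0n // mulr_sumr.
  apply: le_trans (expect_exists _ _ _ _) _; apply: ler_sum => B BF.
  apply: le_trans (expect_exists _ _ _ _) _; rewrite mulr_sumr; apply: ler_sum => w _.
  by apply: H; rewrite /= BF; apply: leq_ltn_trans Qt.
- rewrite expect_and [leRHS]mulrCA; case: ltnP => [t0|]; last by rewrite !mul0r.
  rewrite ler_wpM2l ?ler0n // mulr_sumr.
  apply: le_trans (expect_exists _ _ _ _) _; apply: ler_sum => B BF.
  apply: le_trans (expect_exists _ _ _ _) _; rewrite mulr_sumr; apply: ler_sum => w _.
  apply: le_trans (expect_exists _ _ _ _) _; rewrite mulr_sumr; apply: ler_sum => u _.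
  by apply: H; rewrite /= BF t0.
Qed.

Hypothesis unifF : forall B, B \in F -> #|B| = k.

(** Averaged over the bit, reading an update of v preserves the probability of
    the forced bits: a vertex of Z is removed, but only one of its two bits is
    admissible. *)
Lemma reveal_prob_wait Z v :
  (((v \in Z) ==> true)%:R + ((v \in Z) ==> false)%:R) * reveal_prob (Z :\ v)
  = 2 * reveal_prob Z.
Proof.
rewrite /reveal_prob implybT implybF (cardsD1 v Z).
case: (v \in Z) => /=; rewrite ?add0n ?add1n ?exprS; first by field.
by rewrite mulrC.
Qed.

Lemma reveal_prob_place Z A v : A \in F -> v \in A ->
  reveal_prob ((Z :|: A) :\ v) =
  2 * 2^-1 ^+ (k - #|A :&: Z|) * reveal_prob Z.
Proof.
move=> AF vA; rewrite /reveal_prob.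
have -> : (2^-1 : R) ^+ #|(Z :|: A) :\ v| = 2 * 2^-1 ^+ #|Z :|: A|.
  by rewrite [in RHS](cardsD1 v (Z :|: A)) !inE vA orbT add1n exprS; field.
rewrite -mulrA -exprD; congr (_ * _ ^+ _).
have := cardsUI Z A; rewrite (unifF AF) [Z :&: A]setIC => e.
have : (#|A :&: Z| <= k)%N by rewrite -(unifF AF) subset_leq_card ?subsetIl.
by move: e; set a1 := #|Z :|: A|; set a2 := #|A :&: Z|; set a3 := #|Z|; lia.
Qed.

Lemma expect_wait N m beta Z v (e : bool) st : 0 <= beta -> bounded_at N m beta -> (e -> relevant st) ->
  ((v \in Z) ==> true)%:R * (e%:R * expect N (fun L => (explores m L (Z :\ v) st)%:R)) +
  ((v \in Z) ==> false)%:R * (e%:R * expect N (fun L => (explores m L (Z :\ v) st)%:R))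
  <= 2 * (beta * reveal_prob Z) * (e%:R * potential st).
Proof.
move=> b0 H rst; rewrite -mulrDl.
case: e rst => [/(_ isT) rst|_]; last first.
  by rewrite !mul0r !mulr0.
have := H (Z :\ v) st rst; set p := expect _ _ => Hp.
have s0 : 0 <= ((v \in Z) ==> true)%:R + ((v \in Z) ==> false)%:R :> R.
  by rewrite addr_ge0 ?ler0n.
apply: le_trans (_ : (((v \in Z) ==> true)%:R + ((v \in Z) ==> false)%:R) *
  (true%:R * (beta * reveal_prob (Z :\ v) * potential st)) <= _).
  by rewrite ler_wpM2l // ler_wpM2l ?ler0n.
rewrite le_eqVlt; apply/orP; left; apply/eqP.
set s := (_ + _); have -> : s * (true%:R * (beta * reveal_prob (Z :\ v) * potential st)) =
   (s * reveal_prob (Z :\ v)) * beta * (true%:R * potential st) by ring.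
by rewrite reveal_prob_wait; ring.
Qed.


Lemma expect_reveal N m beta Z v (e g full : bool) st A Q :
  bounded_at N m beta -> (e -> relevant st) -> 0 <= beta -> A \in F ->
  expect N (fun L => (((v \in Z) ==> true) &&
     ((e && explores m L (Z :\ v) st) ||
      [&& v \in A, true, g & successor F theta (explores m L) Z A v Q full]))%:R) +
  expect N (fun L => (((v \in Z) ==> false) &&
     ((e && explores m L (Z :\ v) st) ||
      [&& v \in A, false, g & successor F theta (explores m L) Z A v Q full]))%:R)
  <= 2 * (beta * reveal_prob Z) *
     (e%:R * potential st +
      (v \in A)%:R * (g%:R * (2^-1 ^+ (k - #|A :&: Z|) * successor_cost A v Q full))).
Proof.
move=> H rst b0 AF; rewrite !expect_and.
rewrite [X in _ + _ * X](expect_eq (g := fun L => (e && explores m L (Z :\ v) st)%:R));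
  last by move=> L _; rewrite /= andbF orbF.
rewrite expect_and mulrDr; set p := expect _ _; set s2 := (_ ==> false)%:R.
have := expect_wait Z v b0 H rst; rewrite -/s2 implybT mul1r => Hw.
set c := 2 * _ in Hw *.
rewrite [X in X * _](_ : _ = 1) ?mul1r //.
apply: le_trans (_ : e%:R * expect N (fun L => (explores m L (Z :\ v) st)%:R) +
   (v \in A)%:R * (g%:R * (beta * reveal_prob ((Z :|: A) :\ v) * successor_cost A v Q full))
   + s2 * (e%:R * expect N (fun L => (explores m L (Z :\ v) st)%:R)) <= _).
  rewrite lerD2r; apply: le_trans (expect_or _ _ _ _) _.
  rewrite expect_and lerD2l expect_and ler_wpM2l ?ler0n //= expect_and ler_wpM2l ?ler0n //.
  exact: expect_successor.
rewrite addrAC; apply: lerD; first exact: Hw.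
case vA: (v \in A); last by rewrite !mul0r mulr0.
rewrite reveal_prob_place // !mul1r /c.
rewrite le_eqVlt; apply/orP; left; apply/eqP; ring.
Qed.

Hypothesis V0 : (0 < #|V|)%N.
Local Notation n := (#|V|%:R : R).

(** D v is the share of the update of v in the expected potential after one
    step. *)
Lemma expect_step N m beta Z st (D : V -> R) :
  (forall v, expect N (fun L => (explores m.+1 ((v, true) :: L) Z st)%:R) +
             expect N (fun L => (explores m.+1 ((v, false) :: L) Z st)%:R)
     <= 2 * (beta * reveal_prob Z) * D v) ->
  0 <= beta -> \sum_v D v <= (n - lam) * potential st ->
  expect N.+1 (fun L => (explores m.+1 L Z st)%:R) <=
  beta * (1 - lam / n) * reveal_prob Z * potential st.
Proof.
move=> H b0 HD.
have nz : n != 0 by rewrite pnatr_eq0 -lt0n.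
have n0 : 0 < n by rewrite ltr0n.
rewrite [leLHS]/expect -/expect.
apply: le_trans (_ : (2 * n)^-1 * (2 * (beta * reveal_prob Z) * \sum_v D v) <= _).
  rewrite ler_wpM2l ?invr_ge0 ?mulr_ge0 ?ler0n // mulr_sumr.
  by apply: ler_sum => v _; exact: H.
apply: le_trans (_ : (2 * n)^-1 * (2 * (beta * reveal_prob Z) * ((n - lam) * potential st)) <= _).
  rewrite ler_wpM2l ?invr_ge0 ?mulr_ge0 ?ler0n // ler_wpM2l ?mulr_ge0 ?reveal_prob_ge0 //.
rewrite le_eqVlt; apply/orP; left; apply/eqP; field.
by [].
Qed.

Definition place_cost A Q full : R :=
  2^-1 ^+ (k - #|Q|) * \sum_(v in A) successor_cost A v Q full.

Hypothesis lam1 : 0 <= lam <= 1.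
(* A state Overlap A Q with #|Q| = q loses a vertex at rate q and produces the
   successors of A at rate place_cost; the potential has to dominate both and
   to leave a margin lam. *)
Hypothesis decrO : forall q, q%:R * fO q.-1 <= (q%:R - lam) * fO q.
Hypothesis superO : forall A Q, A \in F -> Q \subset A -> Q != set0 ->
  #|Q|%:R * fO #|Q|.-1 + place_cost A Q true <= (#|Q|%:R - lam) * fO #|Q|.
Hypothesis superW : forall A Q, (0 < theta)%N -> A \in F -> Q \subset A ->
  (2 * #|Q| <= k)%N -> place_cost A Q true <= (1 - lam) * fW.
Hypothesis superDW : forall A, (0 < theta)%N -> A \in F ->
  place_cost A set0 false <= (1 - lam) * fDW.
Hypothesis superD : (0 < theta)%N -> fDW <= (1 - lam) * fD.

Lemma sum_except w (a : R) : \sum_(v : V) (v != w)%:R * a = (n - 1) * a.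
Proof.
rewrite (bigD1 w) //= eqxx mul0r add0r (eq_bigr (fun=> a)) => [|v ->]; last by rewrite mul1r.
rewrite sumr_const cardC1 -(mulr_natl a) -[in RHS](prednK V0) -natr1; ring.
Qed.

Lemma sum_indicator A (g : bool) (b : R) (f : V -> R) :
  \sum_v (v \in A)%:R * (g%:R * (b * f v)) = g%:R * (b * \sum_(v in A) f v).
Proof.
rewrite mulr_sumr mulr_sumr [RHS]big_mkcond /=; apply: eq_bigr => v _.
by case: (v \in A); rewrite ?mul1r ?mul0r.
Qed.

Lemma sum_if Q (a b : R) :
  \sum_(v : V) (if v \in Q then a else b) = #|Q|%:R * a + (n - #|Q|%:R) * b.
Proof.
rewrite (eq_bigr (fun v => b + (v \in Q)%:R * (a - b))) => [|v _]; last first.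
  by case: (v \in Q); rewrite ?mul1r ?mul0r ?addr0 // addrC subrK.
rewrite big_split /= -mulr_suml -natr_sum -big_mkcond /= sum1_card.
by rewrite sumr_const cardT -cardE -(mulr_natl b); ring.
Qed.

Lemma bounded_step N m beta : 0 <= beta -> bounded_at N m beta ->
  bounded_at N.+1 m.+1 (beta * (1 - lam / n)).
Proof.
move=> b0 H Z st; case: st => [A Q|w A|c w A|w A|u] rel.
- case/andP: rel => AF Q0.
  pose D v := (if v \in Q then fO #|Q|.-1 else fO #|Q|) +
    (v \in A)%:R * ((A :&: Z == Q)%:R * (2^-1 ^+ (k - #|A :&: Z|) * successor_cost A v Q true)).
  apply: (expect_step (D := D)) => // [v|].
    apply: le_trans (expect_reveal Z v (A :&: Z == Q) true Q H (e := Q :\ v != set0) (st := Overlap A (Q :\ v)) _ b0 AF) _.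
      by move=> e; rewrite /= AF.
    rewrite ler_wpM2l ?mulr_ge0 ?reveal_prob_ge0 // lerD2r /=.
    apply: le_trans (_ : 1 * fO #|Q :\ v| <= _); first by rewrite ler_wpM2r // lern1 leq_b1.
    by rewrite mul1r (cardsD1 v Q); case: (v \in Q).
  rewrite /D big_split /= sum_indicator sum_if.
  case: eqP => [e|_]; last first.
    rewrite mul0r addr0 (_ : (n - lam) * _ = (n - #|Q|%:R) * fO #|Q| + (#|Q|%:R - lam) * fO #|Q|); last by ring.
    by rewrite addrC lerD2l.
  have QA : Q \subset A by rewrite -e subsetIl.
  have := superO AF QA Q0; rewrite /place_cost e mul1r.
  by set s := _ * \sum_(i in A) _ => h; lra.
- case/andP: rel => AF t0.
  pose D v := (v != w)%:R * fW +
    (v \in A)%:R * ((2 * #|A :&: Z| <= k)%N%:R * (2^-1 ^+ (k - #|A :&: Z|) * successor_cost A v (A :&: Z) true)).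
  apply: (expect_step (D := D)) => // [v|].
    by apply: (expect_reveal Z v (2 * #|A :&: Z| <= k)%N true (A :&: Z) H (e := v != w) (st := Witness w A) _ b0 AF); rewrite /= AF.
  rewrite /D big_split /= sum_indicator sum_except.
  case: leqP => small; last by rewrite mul0r addr0 ler_wpM2r // lerD2l lerN2; case/andP: lam1.
  have := superW t0 AF (subsetIl A Z) small; rewrite /place_cost mul1r.
  by set s := _ * \sum_(i in A) _ => h; lra.
- case/andP: (rel) => AF t0.
  pose D v := (v != c)%:R * fD + (v == c)%:R * fDW.
  apply: (expect_step (D := D)) => // [v|].
    case: (eqVneq v c) => vc; rewrite /= ?vc ?eqxx ?(negbTE vc) /D /= ?mul0r ?mul1r ?add0r ?addr0 !expect_and.
      have := @expect_wait N m beta Z c true (DetourWitness w A) b0 H (fun=> rel).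
      by rewrite !mul1r eqxx mul0r mul1r add0r.
    have := @expect_wait N m beta Z v true (Detour c w A) b0 H (fun=> rel).
    by rewrite /= !mul1r vc (negbTE vc) mul0r addr0 mul1r.
  rewrite /D big_split /= sum_except (bigD1 c) //= eqxx mul1r big1 ?addr0 => [|v /negbTE->]; last by rewrite mul0r.
  by have := superD t0; lra.
- case/andP: rel => AF t0.
  pose D v := (v != w)%:R * fDW +
    (v \in A)%:R * ((A :&: Z == set0)%:R * (2^-1 ^+ (k - #|A :&: Z|) * successor_cost A v set0 false)).
  apply: (expect_step (D := D)) => // [v|].
    by apply: (expect_reveal Z v (A :&: Z == set0) false set0 H (e := v != w) (st := DetourWitness w A) _ b0 AF); rewrite /= AF.
  rewrite /D big_split /= sum_indicator sum_except.
  case: eqP => e; last by rewrite mul0r addr0 ler_wpM2r // lerD2l lerN2; case/andP: lam1.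
  have := superDW t0 AF; rewrite /place_cost e mul1r.
  by set s := _ * \sum_(i in A) _ => h; lra.
- pose D v := (v != u)%:R * fS.
  apply: (expect_step (D := D)) => // [v|].
    rewrite /= !expect_and; apply: (@expect_wait N m beta Z v _ (Survivor u)) => //.
  by rewrite /D sum_except /= ler_wpM2r // lerD2l lerN2; case/andP: lam1.
Qed.

Lemma expect_all_latest_one N Z :
  expect N (fun L => (all_latest_one L Z)%:R) <= reveal_prob Z.
Proof.
elim: N Z => [|N IH] Z /=.
  by case: eqP => [->|_]; rewrite /reveal_prob ?cards0 ?expr0 ?exprn_ge0 ?invr_ge0 ?ler0n.
have nz : n != 0 by rewrite pnatr_eq0 -lt0n.
apply: le_trans (_ : (2 * n)^-1 * \sum_(v : V) (2 * reveal_prob Z) <= _).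
  rewrite ler_wpM2l ?invr_ge0 ?mulr_ge0 ?ler0n //; apply: ler_sum => v _.
  rewrite !expect_and -(reveal_prob_wait Z v) mulrDl.
  by apply: lerD; rewrite ler_wpM2l ?ler0n.
rewrite sumr_const cardT -cardE -(mulr_natl (2 * _)) le_eqVlt; apply/orP; left.
by apply/eqP; field.
Qed.

(** At the end of the window only the forced bits remain to be read; there the
    potential, normalised by K, is at least 1. *)
Lemma explores_bound K m Z st :
  0 <= K -> (forall st', relevant st' -> 1 <= K * potential st') -> relevant st ->
  expect (m + T0) (fun L => (explores m L Z st)%:R) <=
  K * (1 - lam / n) ^+ m * reveal_prob Z * potential st.
Proof.
move=> K0 HK; have zp : 0 <= 1 - lam / n.
  rewrite subr_ge0 ler_pdivrMr ?ltr0n // mul1r; case/andP: lam1 => _ h.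
  by apply: le_trans h _; rewrite ler1n.
have H : bounded_at (m + T0) m (K * (1 - lam / n) ^+ m).
  elim: m => [|m IH].
    move=> Z1 st1 /HK rel; rewrite expr0 mulr1 add0n mulrAC.
    apply: le_trans (expect_all_latest_one _ _) _.
    by rewrite ler_peMl ?reveal_prob_ge0.
  rewrite exprSr mulrA addSn; apply: bounded_step => //.
  by rewrite mulr_ge0 ?exprn_ge0.
exact: H.
Qed.

End Potential.

(** * Counting continuations *)

Section Counting.
Variables (R : realFieldType) (V : finType) (F : {set {set V}}) (k Delta : nat).
Implicit Types (A B Q : {set V}) (u v w : V).
Hypothesis unifF : forall B, B \in F -> #|B| = k.
Hypothesis degF : forall v, (degree F v <= Delta)%N.

Lemma sum_meet A : (\sum_(B in F) #|A :&: B| <= #|A| * Delta)%N.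
Proof.
rewrite (eq_bigr (fun B => \sum_(w in A) (w \in B))%N) => [|B _]; last first.
  rewrite -sum1_card big_mkcond [RHS]big_mkcond /=; apply: eq_bigr => w _.
  by rewrite inE; case: (w \in A); case: (w \in B).
rewrite exchange_big /= -sum_nat_const; apply: leq_sum => w _.
apply: leq_trans (degF w); rewrite /degree -sum1_card big_mkcond [leqRHS]big_mkcond /=.
by apply: leq_sum => B _; rewrite !inE; case: (B \in F); case: (w \in B).
Qed.

Variables (theta : nat) (fO : nat -> R) (fW fD fS : R).
Hypotheses (fW_ge0 : 0 <= fW) (fD_ge0 : 0 <= fD).

(** The part of the cost that needs care; the other successors are counted
    crudely. *)
Definition overlap_cost A Q : R :=
  \sum_(v in A) \sum_(B in F) ((theta <= #|Q|)%N || (v \notin B :\: Q))%:R *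
     fO #|((A :&: B) :\: Q) :\ v|.

Lemma sum_succ_cost A Q full : A \in F ->
  \sum_(v in A) successor_cost F theta fO fW fD fS A v Q full <=
  k%:R ^+ 2 * fS + (full%:R * overlap_cost A Q +
   ((#|Q| < theta)%N%:R * (k%:R ^+ 2 * Delta%:R * fW) +
    (0 < theta)%N%:R * (k%:R ^+ 3 * Delta%:R * fD))).
Proof.
move=> AF; have cA := unifF AF.
have meetR : (\sum_(B in F) #|A :&: B|%:R : R) <= k%:R * Delta%:R.
  by rewrite -natr_sum -natrM ler_nat -cA; exact: sum_meet.
rewrite /successor_cost !big_split /=; do 3?apply: lerD.
- by rewrite !sumr_const cA -mulrnA -(mulr_natl fS) natrM expr2.
- rewrite -mulr_sumr ler_wpM2l ?ler0n // le_eqVlt; apply/orP; left; apply/eqP.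
  apply: eq_bigr => v _; apply: eq_bigr => B _; congr (_ * fO #|_|%N).
  by rewrite setDDl setUC.
- rewrite -mulr_sumr ler_wpM2l ?ler0n // sumr_const cA -[leLHS]mulr_natl.
  rewrite (_ : k%:R ^+ 2 * _ * _ = k%:R * (k%:R * Delta%:R * fW)); last by ring.
  rewrite ler_wpM2l ?ler0n //.
  rewrite (eq_bigr (fun B => #|A :&: B|%:R * fW)) => [|B _]; last by rewrite sumr_const mulr_natl.
  by rewrite -mulr_suml ler_wpM2r.
- rewrite -mulr_sumr ler_wpM2l ?ler0n // sumr_const cA -[leLHS]mulr_natl.
  rewrite (eq_bigr (fun B => #|A :&: B|%:R * (k%:R * fD))) => [|B BF]; last first.
    by rewrite !sumr_const unifF // !mulr_natl.
  rewrite -mulr_suml [leRHS](_ : _ = k%:R * ((k%:R * Delta%:R) * (k%:R * fD))); last by ring.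
  by rewrite ler_wpM2l ?ler0n // ler_wpM2r // mulr_ge0 ?ler0n.
Qed.

End Counting.

(** * Supersolution for general hypergraphs *)

Ltac nat_lia :=
  repeat match goal with
  | H : is_true (@Order.le _ _ _ _) |- _ => clear H
  | H : is_true (@Order.lt _ _ _ _) |- _ => clear H
  | H : @eq ?T _ _ |- _ => lazymatch T with nat => fail | bool => fail | _ => clear H end
  end; lia.

Section OverlapCost.
Variables (R : realFieldType) (V : finType) (F : {set {set V}}) (k Delta theta : nat).
Implicit Types (A B Q : {set V}) (u v w : V).
Hypothesis unifF : forall B, B \in F -> #|B| = k.
Hypothesis degF : forall v, (degree F v <= Delta)%N.
Variable fO : nat -> R.
Hypotheses (fO_ge0 : forall q, 0 <= fO q).

(** Among the k update vertices v of A, those outside B or in Q leave the whole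
    of J as new overlap with B, while v in J removes v from J; the latter is
    allowed for large Q only. *)
Lemma overlap_cost_split A Q : A \in F ->
  overlap_cost F theta fO A Q <= \sum_(B in F)
   ((k - #|(A :&: B) :\: Q|)%:R * fO #|(A :&: B) :\: Q| +
    (theta <= #|Q|)%N%:R * (#|(A :&: B) :\: Q|%:R * fO #|(A :&: B) :\: Q|.-1)).
Proof.
move=> AF; rewrite /overlap_cost exchange_big /=; apply: ler_sum => B BF.
set J := (A :&: B) :\: Q; set t := (theta <= _)%N.
have JA : J \subset A by apply/subsetP => w; rewrite !inE => /andP[_ /andP[]].
pose a := t%:R * fO #|J|.-1; pose b := fO #|J|.
apply: le_trans (_ : \sum_(v in A) (b + (v \in J)%:R * (a - b)) <= _).
  apply: ler_sum => v vA; case vJ: (v \in J).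
    have -> : v \notin B :\: Q = false.
      by move: vJ; rewrite !inE => /andP[-> /andP[_ ->]].
    by rewrite orbF mul1r addrC subrK /a -/t (cardsD1 v J) vJ add1n.
  by rewrite mul0r addr0 /b (cardsD1 v J) vJ add0n ler_piMl // lern1 leq_b1.
have -> : \sum_(v in A) (b + (v \in J)%:R * (a - b)) = #|A|%:R * b + #|J|%:R * (a - b).
  rewrite big_split /= sumr_const -mulr_suml -natr_sum -(mulr_natl b); congr (_ + _%:R * _).
  rewrite -sum1_card big_mkcond [RHS]big_mkcond /=; apply: eq_bigr => v _.
  case: ifP => vA; case: ifP => vJ //.
  by have := subsetP JA v vJ; rewrite vA.
rewrite (unifF AF) natrB; last by rewrite -(unifF AF) subset_leq_card.
by rewrite /a /b le_eqVlt; apply/orP; left; apply/eqP; ring.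
Qed.

Lemma sum_fresh_meet A Q : A \in F -> Q \subset A ->
  (\sum_(B in F) #|(A :&: B) :\: Q| <= (k - #|Q|) * Delta)%N.
Proof.
move=> AF QA; have := sum_meet degF (A :\: Q).
rewrite cardsD (setIidPr QA) (unifF AF); apply: leq_trans.
by rewrite leq_eqVlt (eq_bigr (fun B => #|(A :\: Q) :&: B|)) ?eqxx // => B _; rewrite setIDAC.
Qed.

(** The edges B are charged in proportion to their overlap j with A off Q, since
    the sum of these overlaps is at most (k - q) Delta. *)
Lemma overlap_cost_linear_bound A Q (X : R) : A \in F -> Q \subset A -> 0 <= X ->
  (forall j, (0 < j)%N -> (j + #|Q| <= k)%N ->
    (k - #|Q|)%:R * ((k - j)%:R * fO j + (theta <= #|Q|)%N%:R * (j%:R * fO j.-1))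
      <= j%:R * X) -> fO 0%N = 0 ->
  overlap_cost F theta fO A Q <= Delta%:R * X.
Proof.
move=> AF QA X0 HX fO0; apply: le_trans (overlap_cost_split Q AF) _.
have Qk : (#|Q| <= k)%N by rewrite -(unifF AF) subset_leq_card.
set S := \sum_(B in F) _.
have cardJ B : (#|(A :&: B) :\: Q| + #|Q| <= k)%N.
  have : (A :&: B) :\: Q \subset A :\: Q.
    by apply/subsetP => w; rewrite !inE => /andP[-> /andP[->]].
  move/subset_leq_card; rewrite (cardsD A) (setIidPr QA) (unifF AF); lia.
have H : (k - #|Q|)%:R * S <= (k - #|Q|)%:R * (Delta%:R * X).
  rewrite mulrA -natrM mulr_sumr.
  apply: le_trans (_ : \sum_(B in F) #|(A :&: B) :\: Q|%:R * X <= _).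
    apply: ler_sum => B BF; case: (posnP #|(A :&: B) :\: Q|) => [->|j0].
      by rewrite fO0 mulr0 !mul0r mulr0 addr0 mulr0.
    exact: HX.
  by rewrite -mulr_suml ler_wpM2r // -natr_sum ler_nat sum_fresh_meet.
case: (posnP (k - #|Q|)%N) => e; last by rewrite -(ler_pM2l (x := (k - #|Q|)%:R)) ?ltr0n.
rewrite /S big1 ?mulr_ge0 ?ler0n // => B BF.
have -> : #|(A :&: B) :\: Q| = 0%N by have := cardJ B; lia.
by rewrite fO0 mulr0 mul0r mulr0 addr0.
Qed.

End OverlapCost.

(** With y^8 = 2 the potential of an overlap of size q is 2^(q/2), the geometric
    mean that makes the two consecutive overlaps q and j, with q + j <= k,
    cost 2^(-k/2) per step.  The margin 2^(k/8) = y^k remains for polynomials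
    in k, which are absorbed into the constant K. *)
Section GeneralCase.
Variables (R : realFieldType) (y K eps : R).
Hypotheses (eps0 : 0 < eps) (eps_small : 64 * eps <= 1).
Hypotheses (y1 : 1 <= y) (y8 : y ^+ 8 = 2) (K1 : 1 <= K).
Hypothesis polyK : forall n : nat, n.+1%:R ^+ 7 <= K * y ^+ n.

Let y0 : 0 < y. Proof. exact: lt_le_trans ltr01 y1. Qed.
Let yX n : 0 < y ^+ n. Proof. exact: exprn_gt0. Qed.

Definition overlap_weight (q : nat) : R := if q is 0 then 0 else y ^+ (4 * q).

Lemma y_le m n : (m <= n)%N -> y ^+ m <= y ^+ n.
Proof. by move=> mn; rewrite ler_weXn2l. Qed.

Lemma overlap_weight_ge0 q : 0 <= overlap_weight q.
Proof. by case: q => //= q; apply: ltW. Qed.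

Lemma overlap_weight_le q m : (q <= m)%N -> overlap_weight q <= y ^+ (4 * m).
Proof.
by case: q => [|q] qm; [apply: ltW | apply: y_le; rewrite leq_mul2l].
Qed.

Lemma pow_le_K d n : (d <= 7)%N -> n%:R ^+ d <= K * y ^+ n.
Proof.
move=> d7; apply: le_trans (polyK n).
apply: le_trans (_ : n.+1%:R ^+ d <= _).
  by rewrite lerXn2r ?nnegrE ?ler0n // ler_nat.
by rewrite ler_weXn2l // ler1n.
Qed.

Lemma half_pow m : (2^-1 : R) ^+ m = (y ^+ (8 * m))^-1.
Proof. by rewrite exprM y8 exprVn. Qed.

Lemma overlap_weight_pred q :
  q%:R * overlap_weight q.-1 <= 3 / 4 * (q%:R * y ^+ (4 * q)).
Proof.
have yy : 4 / 3 <= y ^+ 4.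
  rewrite leNgt; apply/negP => h.
  have := y8; rewrite (_ : 8 = 4 * 2)%N // exprM => e.
  by have := yX 4; nra.
rewrite [leRHS]mulrCA ler_wpM2l ?ler0n //.
case: q => [|[|q']] /=; [by rewrite mulr_ge0 // ltW..|].
rewrite [in leRHS]mulnS exprD.
by have := yX (4 * q'.+1); move: (y ^+ (4 * q'.+1)) => z; nra.
Qed.

Lemma overlap_weight_decr q :
  q%:R * overlap_weight q.-1 <= (q%:R - 8^-1) * overlap_weight q.
Proof.
case: q => [|q]; first by rewrite mul0r mulr0.
apply: le_trans (overlap_weight_pred q.+1) _; rewrite mulrA ler_wpM2r ?ltW //.
have : (1 : R) <= q.+1%:R by rewrite ler1n.
by lra.
Qed.

(** This is where the powers of k cancel: if k = q + j + s, then
    (k - q)(k - j) <= j q (1 + s)^2, and the unused part s gains 2^(s/2). *)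
Lemma overlap_tradeoff q j k : (0 < q)%N -> (0 < j)%N -> (j + q <= k)%N ->
  (k - q)%:R * ((k - j)%:R * y ^+ (4 * j)) <= j%:R * (K * q%:R * y ^+ (4 * (k - q))).
Proof.
move=> q0 j0 jqk; pose s := (k - q - j)%N.
have -> : (k - q)%N = (j + s)%N by rewrite /s; nat_lia.
have -> : (k - j)%N = (q + s)%N by rewrite /s; nat_lia.
have h1 : ((j + s)%:R : R) <= j%:R * s.+1%:R by rewrite -natrM ler_nat; nia.
have h2 : ((q + s)%:R : R) <= q%:R * s.+1%:R by rewrite -natrM ler_nat; nia.
have h3 : (s.+1%:R : R) ^+ 2 <= K * y ^+ (4 * s).
  apply: le_trans (_ : s.+1%:R ^+ 7 <= _); first by rewrite ler_weXn2l ?ler1n.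
  apply: le_trans (polyK s) _; rewrite ler_wpM2l ?(le_trans ler01) //.
  by apply: y_le; nat_lia.
apply: le_trans (_ : (j%:R * s.+1%:R) * ((q%:R * s.+1%:R) * y ^+ (4 * j)) <= _).
  apply: ler_pM => //; last by rewrite ler_wpM2r // ltW.
  by rewrite mulr_ge0 // ltW.
rewrite mulnDr exprD.
have -> : j%:R * s.+1%:R * (q%:R * s.+1%:R * y ^+ (4 * j)) =
  (j%:R * q%:R * y ^+ (4 * j)) * s.+1%:R ^+ 2 by ring.
have -> : j%:R * (K * q%:R * (y ^+ (4 * j) * y ^+ (4 * s))) =
  (j%:R * q%:R * y ^+ (4 * j)) * (K * y ^+ (4 * s)) by ring.
by rewrite ler_wpM2l // !mulr_ge0 ?ler0n // ltW.
Qed.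

Variables (V : finType) (F : {set {set V}}) (k Delta : nat).
Implicit Types (A B Q : {set V}).
Hypothesis unifF : forall B, B \in F -> #|B| = k.
Hypothesis degF : forall v, (degree F v <= Delta)%N.
Hypothesis k1 : (0 < k)%N.
Variable c : R.
Hypotheses (c0 : 0 < c) (cK : c * K = eps).
Hypothesis smallD : Delta%:R <= c * y ^+ (4 * k).
(** The least q with k <= 4 q. *)
Definition small_overlap := ((k + 3) %/ 4)%N.
Local Notation theta := small_overlap.

Definition witness_weight : R := k%:R ^+ 2 * y ^+ (2 * k).
Definition detour_weight : R := (k%:R ^+ 3)^-1.

Let K0 : 0 < K. Proof. exact: lt_le_trans ltr01 K1. Qed.
Let c_small : c <= eps.
Proof. by rewrite -cK ler_peMr // ltW. Qed.
Let thetaE q : (theta <= q)%N = (k <= 4 * q)%N.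
Proof.
rewrite /small_overlap; clear.
by have := divn_eq (k + 3) 4; have := ltn_pmod (k + 3) (isT : 0 < 4)%N; set a := (_ %/ _)%N; set b := (_ %% _)%N; nat_lia.
Qed.
Let k0R : 0 < k%:R :> R. Proof. by rewrite ltr0n. Qed.

Lemma cpow_le d m n : (d <= 7)%N -> (m + k <= n)%N ->
  c * (k%:R ^+ d * y ^+ m) <= eps * y ^+ n.
Proof.
move=> d7 mn; rewrite -cK -mulrA ler_pM2l //.
apply: le_trans (_ : K * y ^+ k * y ^+ m <= _).
  by rewrite ler_wpM2r ?pow_le_K // ltW.
by rewrite -mulrA -exprD ler_pM2l // y_le // addnC.
Qed.

Local Notation P q := ((y ^+ (8 * (k - q)))^-1).

Lemma P_le q (a b : R) : a <= b * y ^+ (8 * (k - q)) -> P q * a <= b.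
Proof. by move=> h; rewrite mulrC ler_pdivrMr. Qed.

Lemma P_ge0 q : 0 <= P q.
Proof. by rewrite invr_ge0 ltW. Qed.

Lemma Delta_le (a : R) m n d : (d <= 7)%N -> (4 * k + m + k <= n)%N ->
  Delta%:R * (k%:R ^+ d * y ^+ m) <= eps * y ^+ n.
Proof.
move=> d7 mn; apply: le_trans (_ : c * y ^+ (4 * k) * (k%:R ^+ d * y ^+ m) <= _).
  by rewrite ler_wpM2r // mulr_ge0 ?exprn_ge0 // ltW.
rewrite (_ : _ * _ = c * (k%:R ^+ d * y ^+ (4 * k + m))) ?cpow_le //.
by rewrite exprD; ring.
Qed.

Lemma Delta_le0 n : (4 * k <= n)%N -> Delta%:R <= eps * y ^+ n.
Proof.
move=> kn; apply: le_trans smallD _; apply: le_trans (_ : eps * y ^+ (4 * k) <= _).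
  by rewrite ler_wpM2r // ltW.
by rewrite ler_wpM2l ?(ltW eps0) // y_le.
Qed.

Local Notation cost := (place_cost F k theta overlap_weight witness_weight detour_weight c).

Lemma witness_weight_gt0 : 0 < witness_weight.
Proof. by rewrite mulr_gt0 ?exprn_gt0. Qed.

Lemma detour_weight_gt0 : 0 < detour_weight.
Proof. by rewrite invr_gt0 exprn_gt0. Qed.

Lemma cost_le A Q full : A \in F ->
  cost A Q full <= P #|Q| * (k%:R ^+ 2 * c)
    + (full%:R * (P #|Q| * overlap_cost F theta overlap_weight A Q)
    + ((#|Q| < theta)%N%:R * (P #|Q| * (Delta%:R * (k%:R ^+ 4 * y ^+ (2 * k))))
    + P #|Q| * Delta%:R)).
Proof.
move=> AF; rewrite /place_cost half_pow.
have := @sum_succ_cost R V F k Delta unifF degF theta overlap_weight witness_weight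
  detour_weight c (ltW witness_weight_gt0) (ltW detour_weight_gt0) A Q full AF.
move=> /(ler_wpM2l (P_ge0 #|Q|)) h; apply: le_trans h _.
rewrite le_eqVlt; apply/orP; left; apply/eqP; rewrite /detour_weight /witness_weight.
have -> : (0 < theta)%N by rewrite ltnNge thetaE muln0 -ltnNge.
by rewrite /=; field; rewrite !gt_eqF.
Qed.

(** The four costs are those of ending, of an overlap with the next edge, of a
    witness and of a detour.  Witnesses occur for 4 q < k only, where the
    potential leaves a factor 2^(k/8). *)
Lemma cost_overlap A Q : A \in F -> Q \subset A -> Q != set0 ->
  #|Q|%:R * overlap_weight #|Q|.-1 + cost A Q true
   <= (#|Q|%:R - 8^-1) * overlap_weight #|Q|.
Proof.
move=> AF QA Q0; apply: le_trans (lerD (lexx _) (cost_le Q true AF)) _.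
have qk : (#|Q| <= k)%N by rewrite -(unifF AF) subset_leq_card.
have q0 : (0 < #|Q|)%N by rewrite card_gt0.
set q := #|Q| in qk q0 *.
have qR : (1 : R) <= q%:R by rewrite ler1n.
have t1 : P q * (k%:R ^+ 2 * c) <= eps * y ^+ (4 * q).
  have e : (0 + k <= 4 * q + 8 * (k - q))%N by nat_lia.
  have := cpow_le (d := 2) isT e; rewrite expr0 mulr1 mulrC exprD mulrA.
  exact: P_le.
have t4 : P q * Delta%:R <= eps * y ^+ (4 * q).
  by apply: P_le; rewrite -mulrA -exprD; apply: Delta_le0; nat_lia.
have t3 : (q < theta)%N%:R * (P q * (Delta%:R * (k%:R ^+ 4 * y ^+ (2 * k))))
     <= eps * y ^+ (4 * q).
  case: (ltnP q theta) => qt; last by rewrite mul0r mulr_ge0 // ltW.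
  rewrite mul1r; apply: P_le; rewrite -mulrA -exprD; apply: Delta_le => //.
  by move: qt; rewrite ltnNge thetaE; nat_lia.
have t2 : P q * overlap_cost F theta overlap_weight A Q <= 5 * eps * (q%:R * y ^+ (4 * q)).
  apply: le_trans (_ : P q * (Delta%:R * ((K + 4) * q%:R * y ^+ (4 * (k - q)))) <= _).
    rewrite ler_wpM2l ?P_ge0 //; apply: (overlap_cost_linear_bound unifF) => //.
    - exact: overlap_weight_ge0.
    - by rewrite !mulr_ge0 ?addr_ge0 ?ler0n // ltW.
    move=> j j0 jk; rewrite -/q thetaE mulrDr.
    rewrite [leRHS](_ : _ = j%:R * (K * q%:R * y ^+ (4 * (k - q))) +
      j%:R * (4 * q%:R * y ^+ (4 * (k - q)))); last by ring.
    apply: lerD; first by case: j j0 jk => // j _ jk; apply: overlap_tradeoff.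
    case: leqP => kq; last by rewrite mul0r mulr0 !mulr_ge0 ?ler0n // ltW.
    rewrite mul1r mulrCA ler_wpM2l ?ler0n //.
    apply: ler_pM; rewrite ?ler0n ?overlap_weight_ge0 //.
      by rewrite -natrM ler_nat; nat_lia.
    by apply: overlap_weight_le; nat_lia.
  apply: P_le.
  apply: le_trans (_ : c * y ^+ (4 * k) * ((K + 4) * q%:R * y ^+ (4 * (k - q))) <= _).
    by rewrite ler_wpM2r // !mulr_ge0 ?addr_ge0 ?ler0n // ltW.
  have -> : c * y ^+ (4 * k) * ((K + 4) * q%:R * y ^+ (4 * (k - q))) =
     c * (K + 4) * (q%:R * (y ^+ (4 * k) * y ^+ (4 * (k - q)))) by ring.
  have -> : 5 * eps * (q%:R * y ^+ (4 * q)) * y ^+ (8 * (k - q)) =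
     5 * eps * (q%:R * (y ^+ (4 * q) * y ^+ (8 * (k - q)))) by ring.
  rewrite -!exprD (_ : (4 * k + 4 * (k - q) = 4 * q + 8 * (k - q))%N); last by nat_lia.
  rewrite ler_wpM2r ?mulr_ge0 ?ler0n //; first by rewrite ltW.
  by rewrite mulrDr cK; have := c_small; lra.
have t0 := overlap_weight_pred q.
have -> : overlap_weight q = y ^+ (4 * q) by case: (q) q0.
have := yX (4 * q); move: t0 t1 t2 t3 t4; rewrite mul1r mulrBl.
set z := y ^+ (4 * q) => t0 t1 t2 t3 t4 z0.
have zq : z <= q%:R * z by rewrite ler_peMl // ltW.
have e1 : 64 * (eps * z) <= z by rewrite mulrA ler_piMl // ltW.
have e2 : 64 * (eps * (q%:R * z)) <= q%:R * z.
  by rewrite mulrA ler_piMl // (le_trans (ltW z0)).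
move: t0 t1 t2 t3 t4 zq e1 e2; rewrite -[5 * eps * _]mulrA.
move: (q%:R * z) (eps * (q%:R * z)) (eps * z) => qz a1 a2.
by lra.
Qed.

(** Placing A saves 2^(-(k - q)), and the next edge costs Delta 2^((k - q)/2);
    the product is of order 2^(q/2), at most the weight 2^(k/4) of a witness
    since 2 q <= k. *)
Lemma cost_witness A Q : A \in F -> Q \subset A -> (2 * #|Q| <= k)%N ->
  cost A Q true <= (1 - 8^-1) * witness_weight.
Proof.
move=> AF QA small; apply: le_trans (cost_le Q true AF) _.
set q := #|Q| in small *.
have wE : witness_weight = k%:R ^+ 2 * y ^+ (2 * k) by [].
have k2 : (1 : R) <= k%:R ^+ 2 by rewrite exprn_ege1 // ler1n.
have t1 : P q * (k%:R ^+ 2 * c) <= eps * witness_weight.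
  apply: P_le; rewrite wE; set a := y ^+ _; set b := y ^+ _.
  rewrite (_ : eps * _ * _ = k%:R ^+ 2 * (eps * (a * b))); last by ring.
  rewrite ler_wpM2l ?exprn_ge0 //; apply: le_trans c_small _.
  by rewrite ler_peMr ?(ltW eps0) // /a /b -exprD exprn_ege1.
have t4 : P q * Delta%:R <= eps * witness_weight.
  apply: P_le; apply: le_trans (Delta_le0 (n := 8 * (k - q)) _) _; first by nat_lia.
  rewrite ler_wpM2r ?(ltW (yX _)) // ler_peMr ?(ltW eps0) // wE.
  by rewrite mulr_ege1 // exprn_ege1.
have t3 : (q < theta)%N%:R * (P q * (Delta%:R * (k%:R ^+ 4 * y ^+ (2 * k))))
     <= eps * witness_weight.
  case: (ltnP q theta) => qt.
    rewrite mul1r; apply: P_le.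
    rewrite (_ : Delta%:R * _ = (Delta%:R * (k%:R ^+ 2 * y ^+ 0)) * witness_weight); last first.
      by rewrite wE; ring.
    rewrite [leRHS]mulrAC ler_wpM2r ?(ltW witness_weight_gt0) //; apply: Delta_le => //.
    by move: qt; rewrite ltnNge thetaE; nat_lia.
  by rewrite mul0r mulr_ge0 ?(ltW witness_weight_gt0) ?(ltW eps0).
have t2 : P q * overlap_cost F theta overlap_weight A Q <= eps * witness_weight.
  apply: le_trans (_ : P q * (Delta%:R * (k%:R ^+ 2 * y ^+ (4 * (k - q)))) <= _).
    rewrite ler_wpM2l ?P_ge0 //; apply: (overlap_cost_linear_bound unifF) => //.
    - exact: overlap_weight_ge0.
    - by rewrite mulr_ge0 ?exprn_ge0 // ltW.
    move=> j j0 jk; rewrite -/q.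
    set z := y ^+ (4 * (k - q)); have z0 : 0 <= z := ltW (yX _).
    apply: le_trans (_ : k%:R * (k%:R * z) <= _); last first.
      rewrite [leLHS]mulrA -expr2; apply: ler_peMl; last by rewrite ler1n.
      by apply: mulr_ge0 => //; apply: exprn_ge0.
    have b1 i : (i <= j)%N -> overlap_weight i <= z.
      by move=> ij; apply: overlap_weight_le; nat_lia.
    apply: ler_pM; rewrite ?ler0n ?addr_ge0 ?mulr_ge0 ?ler0n ?overlap_weight_ge0 //.
      by rewrite ler_nat leq_subr.
    apply: le_trans (_ : (k - j)%:R * z + j%:R * z <= _); last first.
      by rewrite -mulrDl -natrD subnK //; nat_lia.
    apply: lerD; first by rewrite ler_wpM2l ?ler0n ?b1.
    apply: le_trans (_ : 1 * (j%:R * overlap_weight j.-1) <= _).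
      by rewrite ler_wpM2r ?mulr_ge0 ?overlap_weight_ge0 ?ler0n // lern1 leq_b1.
    by rewrite mul1r ler_wpM2l ?ler0n // b1 // leq_pred.
  apply: P_le; rewrite wE -mulrA -mulrA -exprD.
  apply: le_trans (_ : c * y ^+ (4 * k) * (k%:R ^+ 2 * y ^+ (4 * (k - q))) <= _).
    by rewrite ler_wpM2r // mulr_ge0 ?exprn_ge0 // ltW.
  rewrite (_ : _ * _ = c * (k%:R ^+ 2 * y ^+ (4 * k + 4 * (k - q)))); last by rewrite exprD; ring.
  apply: ler_pM => //; first exact: ltW.
    by rewrite mulr_ge0 ?(ltW (yX _)) // exprn_ge0.
  by rewrite ler_wpM2l ?exprn_ge0 // y_le //; nat_lia.
have := witness_weight_gt0; move: t1 t2 t3 t4; rewrite mul1r => t1 t2 t3 t4 w0.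
have : 64 * (eps * witness_weight) <= witness_weight.
  by rewrite mulrA ler_piMl // ltW.
by lra.
Qed.

(** After a detour all k bits are new, and the next edge is only kept with a
    witness, whose weight 2^(k/4) leaves a gain of 2^(-k/4). *)
Lemma cost_detour A : A \in F ->
  cost A set0 false <= (1 - 8^-1) * ((1 - 8^-1) * detour_weight).
Proof.
move=> AF; apply: le_trans (cost_le set0 false AF) _; rewrite cards0 mul0r add0r.
have th : (0 < theta)%N by rewrite ltnNge thetaE muln0 -ltnNge.
rewrite th mul1r.
have dE (a : R) : k%:R ^+ 3 * a <= eps * y ^+ (8 * (k - 0)) ->
    P 0 * a <= eps * detour_weight.
  move=> h; apply: P_le; rewrite [leRHS]mulrAC /detour_weight ler_pdivlMr ?exprn_gt0 //.
  by rewrite mulrC.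
have t1 : P 0 * (k%:R ^+ 2 * c) <= eps * detour_weight.
  apply: dE; rewrite (_ : _ * _ = c * (k%:R ^+ 5 * y ^+ 0)); last by ring.
  by apply: cpow_le => //; nat_lia.
have t3 : P 0 * (Delta%:R * (k%:R ^+ 4 * y ^+ (2 * k))) <= eps * detour_weight.
  apply: dE; rewrite (_ : _ * _ = Delta%:R * (k%:R ^+ 7 * y ^+ (2 * k))); last by ring.
  by apply: Delta_le => //; nat_lia.
have t4 : P 0 * Delta%:R <= eps * detour_weight.
  apply: dE; rewrite (_ : _ * _ = Delta%:R * (k%:R ^+ 3 * y ^+ 0)); last by ring.
  by apply: Delta_le => //; nat_lia.
have := detour_weight_gt0 => d0.
have : 64 * (eps * detour_weight) <= detour_weight.
  by rewrite mulrA ler_piMl // ltW.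
by lra.
Qed.

End GeneralCase.

(** * Supersolution for linear hypergraphs *)

Section LinearCase.
Variable R : realFieldType.

(** Larger overlaps than 1 arise from repeating an edge.  Their potential must
    grow like 2^q, since an overlap q saves q bits; the denominator q + 2
    reflects that the time until the first of q vertices is updated is n / q,
    and the term q / 2 absorbs the cost k / (8 (k - q + 2)) <= q / 8 of a
    repetition. *)
Definition linear_growth (q : nat) : R := 1 + q%:R / 2 + 2 ^+ q / (8 * (q + 2)%:R).
Definition linear_weight (q : nat) : R := if q is 0 then 0 else linear_growth q.

Lemma linear_growth_gt0 q : 0 < linear_growth q.
Proof.
have h1 : 0 <= (q%:R : R) / 2 by rewrite mulr_ge0 ?ler0n // invr_ge0.
have h2 : 0 <= (2 : R) ^+ q / (8 * (q + 2)%:R).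
  by apply: divr_ge0; rewrite ?exprn_ge0 // mulr_ge0 // ler0n.
rewrite /linear_growth; move: h1 h2; lra.
Qed.

Lemma linear_weight_ge0 q : 0 <= linear_weight q.
Proof. by case: q => //= q; apply: ltW; apply: linear_growth_gt0. Qed.

Lemma linear_weight_le_growth q : linear_weight q <= linear_growth q.
Proof. by case: q => //; apply: ltW; apply: linear_growth_gt0. Qed.

Let natrS2 q : (q.+1%:R = q%:R + 1 :> R) * (q.+2%:R = q%:R + 2 :> R) *
  (q.+3%:R = q%:R + 3 :> R) * (q.+4%:R = q%:R + 4 :> R).
Proof. by do !split; rewrite ?natr1 -?natrD ?addn1 ?addn2 ?addn3 ?addn4. Qed.

Lemma linear_growthS q :
  linear_growth q.+1 = linear_growth q + 2^-1 +
    2 ^+ q * q.+1%:R / (8 * (q.+2%:R * q.+3%:R)).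
Proof.
rewrite /linear_growth exprS (_ : (q + 2)%N = q.+2) ?addn2 // !(natrS2 q).
have := ler0n R q; move: (2 ^+ q) (q%:R : R) => z x x0.
by field; rewrite !gt_eqF //; lra.
Qed.

Lemma linear_weight_homo q q' : (q <= q')%N -> linear_weight q <= linear_weight q'.
Proof.
elim: q' => [|q' IH]; first by rewrite leqn0 => /eqP->.
rewrite leq_eqVlt => /orP[/eqP->//|]; rewrite ltnS => /IH/le_trans; apply.
apply: le_trans (linear_weight_le_growth q') _; rewrite /= linear_growthS.
rewrite -addrA lerDl addr_ge0 ?invr_ge0 //.
Qed.

Lemma linear_weight_gain q : (0 < q)%N ->
  q%:R * linear_weight q.-1 + q%:R / 2 + 2 ^+ q / 48 <= q%:R * linear_growth q.
Proof.
case: q => [//|[|q]] _.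
  by rewrite (_ : linear_weight 1.-1 = 0) // /linear_growth expr1 addn2; lra.
rewrite (_ : linear_weight q.+2.-1 = linear_growth q.+1) //.
rewrite [linear_growth q.+2]linear_growthS; set g := linear_growth q.+1.
suff : (2 : R) ^+ q.+2 / 48 <= q.+2%:R * (2 ^+ q.+1 * q.+2%:R / (8 * (q.+3%:R * q.+4%:R))).
  by rewrite !mulrDr; set t := q.+2%:R * (_ / (8 * _)); lra.
rewrite [2 ^+ q.+2]exprS.
have z0 : (0 : R) < 2 ^+ q.+1 by rewrite exprn_gt0.
rewrite (_ : q.+2%:R * _ = 2 ^+ q.+1 * (q.+2%:R ^+ 2 / (8 * (q.+3%:R * q.+4%:R)))); last by ring.
rewrite (_ : 2 * _ / 48 = 2 ^+ q.+1 * 24^-1); last by field.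
rewrite ler_pM2l // ler_pdivlMr ?mulr_gt0 ?ltr0n //.
have := ler0n R q; rewrite !(natrS2 q); move: (q%:R : R) => x x0.
by nra.
Qed.

Variables (V : finType) (F : {set {set V}}) (k Delta : nat).
Implicit Types (A B Q : {set V}).
Hypothesis unifF : forall B, B \in F -> #|B| = k.
Hypothesis degF : forall v, (degree F v <= Delta)%N.
Hypothesis linF : forall A B, A \in F -> B \in F -> A != B -> (#|A :&: B| <= 1)%N.
Hypothesis k1 : (0 < k)%N.
Variable c : R.
Hypotheses (c0 : 0 < c) (c_small : 512 * c <= 1).
Hypothesis smallD : Delta%:R * (k%:R ^+ 2 * 2^-1 ^+ k) <= c.

(** The edge A itself may be repeated, with overlap at most k - q; any other
    edge meets A in at most one vertex. *)
Lemma overlap_cost_linear A Q : A \in F -> Q \subset A ->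
  overlap_cost F 0 linear_weight A Q <=
  k%:R * (linear_growth (k - #|Q|) + (k - #|Q|)%:R * Delta%:R * 2).
Proof.
move=> AF QA; rewrite mulr_natl -[X in _ *+ X](unifF AF) -sumr_const.
apply: ler_sum => v vA.
rewrite (bigD1 A AF) /= mul1r setIid; apply: lerD.
  apply: le_trans (linear_weight_le_growth _); apply: linear_weight_homo.
  apply: leq_trans (subset_leq_card (subsetDl _ _)) _.
  by rewrite cardsD (setIidPr QA) (unifF AF).
apply: le_trans (_ : \sum_(B in F) #|(A :&: B) :\: Q|%:R * 2 <= _).
  rewrite [leRHS](bigD1 A AF) /= -[leLHS]add0r; apply: lerD.
    by rewrite mulr_ge0 ?ler0n.
  apply: ler_sum => B /andP[BF BA]; rewrite mul1r.
  have j1 : (#|(A :&: B) :\: Q| <= 1)%N.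
    apply: leq_trans (subset_leq_card (subsetDl _ _)) _; apply: linF => //.
    by rewrite eq_sym.
  have : (#|((A :&: B) :\: Q) :\ v| <= #|(A :&: B) :\: Q|)%N.
    exact: subset_leq_card (subsetDl _ _).
  move: j1; move: #|(A :&: B) :\: Q| #|_ :\ v| => [|[|//]] [|[|//]] _ _ //=.
  by rewrite /linear_growth expr1 addn2; lra.
rewrite -mulr_suml ler_wpM2r // -natr_sum -natrM ler_nat.
exact: sum_fresh_meet.
Qed.

(** The presence of an edge forces Delta >= 1, so that the bound on Delta makes
    k^2 2^(-k) small; this is what controls the repetitions of an edge. *)
Lemma linear_supersolution A Q : A \in F -> Q \subset A -> Q != set0 ->
  #|Q|%:R * linear_weight #|Q|.-1 + place_cost F k 0 linear_weight 0 0 c A Q true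
   <= (#|Q|%:R - 16^-1) * linear_weight #|Q|.
Proof.
move=> AF QA Q0.
have qk : (#|Q| <= k)%N by rewrite -(unifF AF) subset_leq_card.
have q0 : (0 < #|Q|)%N by rewrite card_gt0.
have D1 : (1 : R) <= Delta%:R.
  have /card_gt0P[v vA] : (0 < #|A|)%N by rewrite (unifF AF).
  rewrite ler1n; apply: leq_trans (degF v); rewrite card_gt0; apply/set0Pn.
  by exists A; rewrite !inE AF.
have eta : k%:R ^+ 2 * 2^-1 ^+ k <= c.
  by apply: le_trans smallD; rewrite ler_peMl // mulr_ge0 ?exprn_ge0 // invr_ge0.
have := @sum_succ_cost R V F k Delta unifF degF 0 linear_weight 0 0 c (lexx 0) (lexx 0) A Q true AF.
rewrite /place_cost mul1r !mulr0 !addr0 => hs.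
have ho := overlap_cost_linear AF QA.
set q := #|Q| in qk q0 hs ho *.
have smallD' := smallD; set h := (2^-1 : R) ^+ k in eta smallD'.
have h0 : 0 < h by rewrite exprn_gt0 // invr_gt0.
have eh : (2^-1 : R) ^+ (k - q) = 2 ^+ q * h.
  rewrite /h -{2}(subnK qk) exprD mulrCA exprVn -exprMn.
  by rewrite mulfV ?expr1n ?mulr1 // pnatr_eq0.
have ekq : (2 : R) ^+ q * 2 ^+ (k - q) * h = 1.
  by rewrite -exprD subnKC // /h -exprMn mulfV ?expr1n // pnatr_eq0.
rewrite eh; set z := 2 ^+ q in ekq *.
have z0 : 0 < z by rewrite exprn_gt0.
have kR : (1 : R) <= k%:R by rewrite ler1n.
have qR : (1 : R) <= q%:R by rewrite ler1n.
have sq : ((k - q)%:R : R) = k%:R - q%:R by rewrite natrB.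
have c1 : c <= 1 by move: c_small c0; lra.
have t1 : z * h * (k%:R ^+ 2 * c) <= z * c.
  rewrite -mulrA ler_pM2l // mulrA [h * _]mulrC.
  by rewrite ler_piMl ?(ltW c0) //; apply: le_trans eta c1.
have kq0 : 0 <= k%:R - q%:R :> R by rewrite subr_ge0 ler_nat.
have t3 : z * h * (k%:R * ((k - q)%:R * Delta%:R * 2)) <= z * (2 * c).
  rewrite -mulrA ler_pM2l //.
  apply: le_trans (_ : 2 * (Delta%:R * (k%:R ^+ 2 * h)) <= _); last by rewrite ler_pM2l // smallD'.
  rewrite (_ : h * _ = 2 * (Delta%:R * ((k%:R * (k - q)%:R) * h))); last by ring.
  rewrite ler_pM2l // ler_wpM2l ?ler0n // ler_pM2r // expr2 ler_wpM2l ?ler0n //.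
  by rewrite ler_nat leq_subr.
have t2 : z * h * (k%:R * linear_growth (k - q)) <= z * c + q%:R / 8.
  rewrite /linear_growth mulrDr mulrDr; apply: lerD.
    rewrite -mulrA ler_pM2l //; apply: le_trans eta; rewrite mulrC ler_pM2r // expr2.
    by rewrite ler_wpM2l ?ler0n // sq; lra.
  have d0 : 0 < ((k - q + 2)%:R : R) by rewrite ltr0n addn2.
  rewrite (_ : z * h * _ = (z * 2 ^+ (k - q) * h) * (k%:R / (8 * (k - q + 2)%:R))); last by ring.
  rewrite ekq mul1r ler_pdivrMr ?mulr_gt0 //.
  rewrite (_ : q%:R / 8 * _ = q%:R * (k - q + 2)%:R); last by field.
  rewrite natrD sq; move: kR qR kq0.
  by move: (k%:R : R) (q%:R : R) => x w; nra.
have gain := linear_weight_gain q0.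
have -> : linear_weight q = linear_growth q by case: (q) q0.
apply: le_trans (_ : q%:R * linear_weight q.-1 + z * h * (k%:R ^+ 2 * c +
   k%:R * (linear_growth (k - q) + (k - q)%:R * Delta%:R * 2)) <= _).
  rewrite lerD2l ler_pM2l ?mulr_gt0 //.
  by apply: le_trans hs _; rewrite lerD2l.
rewrite [k%:R * (_ + _)]mulrDr mulrDr mulrDr mulrBl.
have lg : linear_growth q <= 1 + q%:R / 2 + z / 24.
  rewrite /linear_growth lerD2l ler_pM2l // lef_pV2 ?posrE ?mulr_gt0 ?ltr0n ?addn2 //.
  by rewrite -natrM ler_nat; nat_lia.
have zc : 512 * (z * c) <= z by rewrite mulrCA ler_piMr // ltW.
move: gain t1 t2 t3 lg zc qR; rewrite [2 * c]mulrC [z * (c * 2)]mulrA -/z.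
move: (z * c) (z * h * _) (z * h * _) (z * h * _) (q%:R * linear_weight _) => zc a1 a2 a3 b.
by lra.
Qed.

End LinearCase.

(** * Coupling and total variation *)

Section TotalVariation.
Variables (R : realType) (V : finType) (F : {set {set V}}).
Hypothesis V0 : (0 < #|V|)%N.
Implicit Types (s r p : config V) (v w : V) (L : seq (V * bool)).
Local Notation Om := (Omega F).
Local Notation law := (glauber_law F R).
Local Notation kernel := (glauber_kernel F R).
Local Notation run := (glauber_run F).

Lemma glauber_kernelE s p : kernel s p = (2 * #|V|%:R)^-1 *
  \sum_v ((p == glauber_step F s (v, true))%:R + (p == glauber_step F s (v, false))%:R).
Proof.
rewrite /glauber_kernel mulr_sumr; apply: eq_bigr => v _.
rewrite -mulrDr mulrA -invfM [#|V|%:R * 2]mulrC; congr (_ * _).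
by rewrite addrC.
Qed.

Lemma sum_pred1 s (f : config V -> R) : s \in Om ->
  \sum_(p in Om) (p == s)%:R * f p = f s.
Proof.
move=> sO; rewrite (bigD1 s) //= eqxx mul1r big1 ?addr0 // => p /andP[_ /negbTE->].
by rewrite mul0r.
Qed.

Lemma sum_indicator1 s : s \in Om -> \sum_(p in Om) (p == s)%:R = 1 :> R.
Proof.
move=> sO; rewrite -[RHS](@sum_pred1 s (fun=> 1) sO).
by apply: eq_bigr => p _; rewrite mulr1.
Qed.

Lemma glauber_law_expect t s p : s \in Om ->
  law t s p = expect t (fun L => (p == run s L)%:R).
Proof.
move=> sO; elim: t p => [|t IH] p //=.
under eq_bigr => r rO do rewrite IH glauber_kernelE mulrCA.
rewrite -mulr_sumr; congr (_ * _).
under [LHS]eq_bigr => r rO do rewrite mulr_sumr.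
rewrite exchange_big /=; apply: eq_bigr => v _.
under eq_bigr => r rO do rewrite mulrDr.
rewrite big_split /=.
have H b : \sum_(r in Om) expect t (fun L => (r == run s L)%:R) * (p == glauber_step F r (v, b))%:R
   = expect t (fun L => (p == glauber_step F (run s L) (v, b))%:R) :> R.
  under eq_bigr => r rO do rewrite mulrC -expect_mull.
  rewrite -expect_sum; apply: expect_eq => L _.
  under eq_bigr => r rO do rewrite mulrC.
  by rewrite sum_pred1 // glauber_run_Omega.
by rewrite !H.
Qed.

(** The kernel is symmetric for each update vertex v separately: off v the two
    configurations have to agree, and then so does the admissibility of the
    value 1 at v. *)
Lemma glauber_kernel_sym s p : s \in Om -> p \in Om -> kernel s p = kernel p s.
Proof.
move=> sO pO; rewrite !glauber_kernelE; congr (_ * _); apply: eq_bigr => v _.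
rewrite /glauber_step /=.
have updE (q q' : config V) b : q == update q' v b = [forall w, (w != v) ==> (q w == q' w)] && (q v == b).
  apply/eqP/andP => [->|[/forallP H /eqP H2]].
    split; last by rewrite ffunE eqxx.
    by apply/forallP => w; apply/implyP => wv; rewrite ffunE (negbTE wv).
  apply/ffunP => w; rewrite ffunE; case: (eqVneq w v) => [->//|wv].
  by apply/eqP; have := H w; rewrite wv.
case ag : [forall w, (w != v) ==> (p w == s w)]; last first.
  have ag' : [forall w, (w != v) ==> (s w == p w)] = false.
    by rewrite -ag; apply: eq_forallb => w; rewrite [s w == _]eq_sym.
  have ps : (p == s) = false.
    apply: contraFF ag => /eqP->; apply/forallP => w; by rewrite eqxx implybT.
  rewrite !updE ag ag' /=.
  by do 2!case: ifP => _; rewrite ?updE ?ag ?ag' ?ps ?(eq_sym s p) ?ps.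
have ag' : [forall w, (w != v) ==> (s w == p w)] = true.
  by rewrite -ag; apply: eq_forallb => w; rewrite [s w == _]eq_sym.
have eu : update s v true = update p v true.
  apply/eqP; rewrite updE ffunE eqxx andbT; apply/forallP => w; apply/implyP => wv.
  by rewrite ffunE (negbTE wv); have /forallP/(_ w) := ag'; rewrite wv.
rewrite -eu; case: ifP => up.
  rewrite [in RHS]eu !updE ag ag' /=; by case: (p v); case: (s v); rewrite /= ?addr0 ?add0r.
have off (q : config V) : q \in Om -> update q v true = update s v true -> q v = false.
  move=> qO e; apply/negbTE; apply: contraFN up => qv; rewrite -e.
  suff -> : update q v true = q by [].
  by apply/ffunP => w; rewrite ffunE; case: eqP => // ->.
by rewrite !updE ag ag' (off s sO erefl) (off p pO) //= eq_sym.
Qed.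

Lemma glauber_kernel_row s : s \in Om -> \sum_(p in Om) kernel s p = 1.
Proof.
move=> sO; under eq_bigr => p pO do rewrite glauber_kernelE.
rewrite -mulr_sumr exchange_big /= (eq_bigr (fun=> 2)).
  rewrite sumr_const cardT -cardE -[2 *+ _]mulr_natr mulVf //.
  by rewrite mulf_neq0 // pnatr_eq0 -lt0n.
move=> v _; rewrite big_split /=.
by rewrite !sum_indicator1 ?glauber_step_Omega.
Qed.

Lemma glauber_law_column t p : p \in Om -> \sum_(s in Om) law t s p = 1.
Proof.
elim: t p => [|t IH] p pO /=.
  by rewrite -[RHS](sum_indicator1 pO); apply: eq_bigr => s _; rewrite eq_sym.
rewrite exchange_big /=.
under eq_bigr => r rO do rewrite -mulr_suml (IH _ rO) mul1r (glauber_kernel_sym rO pO).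
exact: glauber_kernel_row.
Qed.

Lemma expectN t (f : seq (V * bool) -> R) : expect t (fun L => - f L) = - expect t f.
Proof. by rewrite -mulN1r -expect_mull; apply: expect_eq => L _; rewrite mulN1r. Qed.

Lemma ler_norm_expect t (f : seq (V * bool) -> R) : `|expect t f| <= expect t (fun L => `|f L|).
Proof.
rewrite ler_norml; apply/andP; split; last by apply: expect_le => L _; exact: ler_norm.
rewrite lerNl -mulN1r -expect_mull; apply: expect_le => L _; rewrite mulN1r.
by rewrite -normrN ler_norm.
Qed.

Lemma coupling_law t s r : s \in Om -> r \in Om ->
  \sum_(p in Om) `|law t s p - law t r p| <= 2 * expect t (fun L => (run s L != run r L)%:R).
Proof.
move=> sO rO; rewrite -expect_mull.
apply: le_trans (_ : \sum_(p in Om) expect t (fun L => `|(p == run s L)%:R - (p == run r L)%:R|) <= _).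
  apply: ler_sum => p pO; rewrite !glauber_law_expect //.
  apply: le_trans (ler_norm_expect _ _); rewrite expectD.
  by rewrite expectN.
rewrite -expect_sum; apply: expect_le => L _.
case: (eqVneq (run s L) (run r L)) => [->|_] /=.
  by rewrite mulr0 big1 // => p _; rewrite subrr normr0.
apply: le_trans (_ : \sum_(p in Om) ((p == run s L)%:R + (p == run r L)%:R) <= _).
  apply: ler_sum => p _; apply: le_trans (ler_normB _ _) _.
  by rewrite !ger0_norm ?ler0n.
by rewrite big_split /= !sum_indicator1 ?glauber_run_Omega // mulr1.
Qed.

(** By stationarity the uniform measure is the average of the laws started from
    all independent sets. *)
Lemma tv_dist_le t s (b : R) : s \in Om ->
  (forall r, r \in Om -> expect t (fun L => (run s L != run r L)%:R) <= b) ->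
  tv_dist F (law t s) (@unif_indep V F R) <= b.
Proof.
move=> sO H; rewrite /tv_dist.
have N0 : (0 : R) < #|Om|%:R by rewrite ltr0n; apply/card_gt0P; exists s.
have E p : p \in Om -> `|law t s p - unif_indep F R p| <=
    #|Om|%:R^-1 * \sum_(r in Om) `|law t s p - law t r p|.
  move=> pO; rewrite /unif_indep pO.
  have -> : law t s p - #|Om|%:R^-1 = #|Om|%:R^-1 * \sum_(r in Om) (law t s p - law t r p).
    rewrite sumrB glauber_law_column // sumr_const -[law t s p *+ _]mulr_natl mulrBr mulr1.
    by rewrite mulKf // gt_eqF.
  rewrite normrM ger0_norm ?invr_ge0 ?(ltW N0) // ler_wpM2l ?invr_ge0 ?(ltW N0) //.
  exact: ler_norm_sum.
apply: le_trans (_ : 2^-1 * (#|Om|%:R^-1 * \sum_(r in Om) (2 * b)) <= _).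
  rewrite ler_wpM2l ?invr_ge0 //.
  apply: le_trans (ler_sum _ E) _; rewrite -[leLHS]mulr_sumr ler_wpM2l ?invr_ge0 ?(ltW N0) //.
  rewrite exchange_big /=; apply: ler_sum => r rO.
  by apply: le_trans (coupling_law t sO rO) _; rewrite ler_pM2l // H.
rewrite sumr_const -[2 * b *+ _]mulr_natl mulKf ?gt_eqF // mulKf //.
Qed.

End TotalVariation.

(** * Coalescence and mixing time *)

Section HistoryOfList.
Variable V : finType.

Lemma eq_hist (x x' : nat -> V * bool) t :
  (forall i, (i < t)%N -> x i = x' i) -> hist x t = hist x' t.
Proof.
elim: t => //= t IH H; rewrite H // IH // => i it.
by apply: H; apply: ltnW.
Qed.

Lemma hist_nth y0 (L : seq (V * bool)) : hist (nth y0 (rev L)) (size L) = L.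
Proof.
elim: L => //= y L IH; rewrite rev_cons nth_rcons size_rev ltnn eqxx.
congr (_ :: _); rewrite -[RHS]IH; apply: eq_hist => i iL.
by rewrite nth_rcons size_rev iL.
Qed.

Lemma drop_hist (x : nat -> V * bool) m t : drop m (hist x (t + m)) = hist x t.
Proof.
elim: m => [|m IH]; first by rewrite addn0 drop0.
by rewrite addnS.
Qed.

End HistoryOfList.

Section Coalescence.
Variables (R : realType) (V : finType) (F : {set {set V}}) (k theta Delta m : nat).
Hypothesis V0 : (0 < #|V|)%N.
Hypothesis unifF : forall B, B \in F -> #|B| = k.
Hypothesis degF : forall v, (degree F v <= Delta)%N.
Variables (bS bO : R).
Hypothesis bO0 : 0 <= bO.
Hypothesis survivor_le : forall v,
  expect (m + m) (fun L => (explores F k theta m L set0 (Survivor v))%:R) <= bS.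
Hypothesis overlap_le : forall B v, B \in F -> v \in B ->
  expect (m + m) (fun L => (explores F k theta m L [set v] (Overlap B [set v]))%:R) <= bO.

(** Of the 2 m updates, the m earliest serve to update every vertex, and the m
    latest are the window in which disagreements are traced. *)
Lemma coalescence (s r : config V) : s \in Omega F -> r \in Omega F ->
  expect (m + m) (fun L => (glauber_run F s L != glauber_run F r L)%:R) <=
  #|V|%:R * ((1 - #|V|%:R^-1) ^+ m + bS + Delta%:R * bO).
Proof.
move=> sO rO.
have [v0 _] : exists v : V, v \in V by apply/card_gt0P.
apply: le_trans (_ : expect (m + m) (fun L =>
   [exists w in V, (w \notin map fst (drop m L)) ||
      (explores F k theta m L set0 (Survivor w) ||
       [exists B in [set B in F | w \in B], explores F k theta m L [set w] (Overlap B [set w])])]%:R) <= _).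
  apply: expect_le => L sL; rewrite ler_nat.
  case: eqVneq => // neq; rewrite lt0b; apply/existsP.
  have eL := hist_nth (v0, true) L; rewrite sL in eL; set x := nth _ _ in eL.
  have [v dv] : exists v, disagree F s r x (m + m) v.
    apply/existsP; apply: contraNT neq => /existsPn H; apply/eqP/ffunP => v.
    by have := H v; rewrite /disagree eL negbK => /eqP.
  case: (boolP [forall w, w \in map fst (drop m L)]) => [/forallP all|].
    exists v; apply/orP; right.
    have allh w : w \in map fst (hist x m) by rewrite -(drop_hist x m m) eL.
    have [|[B /andP[BF vB]]] := disagree_explores sO rO theta unifF (fun w => allh w) dv; rewrite eL.
      by move=> ->.
    by move=> eB; apply/orP; right; apply/existsP; exists B; rewrite !inE BF vB eB.
  by rewrite negb_forall => /existsP[w wn]; exists w; rewrite wn.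
apply: le_trans (expect_exists _ _ _ _) _.
rewrite -[X in X%:R * _]/#|V| mulr_natl -sumr_const; apply: ler_sum => w _.
apply: le_trans (expect_or _ _ _ _) _; rewrite -addrA; apply: lerD.
  have := expect_drop V0 m m (fun L => (w \notin map fst L)%:R : R).
  by rewrite expect_not_updated // => <-.
apply: le_trans (expect_or _ _ _ _) _; apply: lerD; first exact: survivor_le.
apply: le_trans (expect_exists _ _ _ _) _.
apply: le_trans (_ : \sum_(B in [set B in F | w \in B]) bO <= _).
  by apply: ler_sum => B; rewrite inE => /andP[BF wB]; apply: overlap_le.
by rewrite sumr_const -[leLHS]mulr_natl ler_wpM2r // ler_nat; apply: degF.
Qed.

End Coalescence.

Section Rate.
Variables (R : realType) (V : finType) (F : {set {set V}}) (k theta Delta : nat).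
Hypothesis V0 : (0 < #|V|)%N.
Hypothesis unifF : forall B, B \in F -> #|B| = k.
Hypothesis degF : forall v, (degree F v <= Delta)%N.
Variables (fO : nat -> R) (fW fD fDW fS lam K : R).
Hypotheses (K0 : 0 <= K) (fS0 : 0 <= fS) (fO0 : 0 <= fO 1%N) (lam16 : 16^-1 <= lam <= 1).
Hypothesis explored : forall m Z st, relevant F theta st ->
  expect (m + m) (fun L => (explores F k theta m L Z st)%:R) <=
  K * (1 - lam / #|V|%:R) ^+ m * reveal_prob R Z * potential fO fW fD fDW fS st.

Lemma coalescence_rate m (s r : config V) : s \in Omega F -> r \in Omega F ->
  expect (m + m) (fun L => (glauber_run F s L != glauber_run F r L)%:R) <=
  #|V|%:R * (1 + K * (fS + Delta%:R * fO 1%N)) * (1 - 16^-1 / #|V|%:R) ^+ m.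
Proof.
move=> sO rO; have n0 : 0 < #|V|%:R :> R by rewrite ltr0n.
have n1 : 1 <= #|V|%:R :> R by rewrite ler1n.
have mono (x : R) : 16^-1 <= x -> x <= 1 ->
    (1 - x / #|V|%:R) ^+ m <= (1 - 16^-1 / #|V|%:R) ^+ m.
  move=> x16 x1.
  have h : 0 <= 1 - x / #|V|%:R.
    by rewrite subr_ge0 ler_pdivrMr // mul1r; apply: le_trans n1.
  have h2 : 1 - x / #|V|%:R <= 1 - 16^-1 / #|V|%:R.
    by rewrite lerD2l lerN2 ler_wpM2r // invr_ge0 ltW.
  by rewrite lerXn2r ?nnegrE //; apply: le_trans h2.
case/andP: lam16 => l16 l1.
set z := (1 - 16^-1 / _) ^+ m in mono *.
have z0 : 0 <= z.
  apply: exprn_ge0; rewrite subr_ge0 ler_pdivrMr // mul1r.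
  by apply: le_trans n1; apply: le_trans l16 l1.
have HS v : expect (m + m) (fun L => (explores F k theta m L set0 (Survivor v))%:R) <= K * z * fS.
  apply: le_trans (explored _ _ _) _ => //=.
  rewrite /reveal_prob cards0 expr0 mulr1 ler_wpM2r // ler_wpM2l //; exact: mono.
have HO B v : B \in F -> v \in B ->
    expect (m + m) (fun L => (explores F k theta m L [set v] (Overlap B [set v]))%:R) <= K * z * fO 1%N.
  move=> BF vB; apply: le_trans (explored _ _ _) _ => //=.
    by rewrite BF; apply/set0Pn; exists v; rewrite inE.
  rewrite /reveal_prob cards1 expr1 ler_wpM2r //.
  apply: le_trans (_ : K * (1 - lam / #|V|%:R) ^+ m * 1 <= _); last first.
    by rewrite mulr1 ler_wpM2l // mono.
  rewrite ler_wpM2l //; last by rewrite invf_le1 // ler1n.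
  rewrite mulr_ge0 // exprn_ge0 // subr_ge0 ler_pdivrMr // mul1r.
  exact: le_trans n1.
have b0 : 0 <= K * z * fO 1%N by rewrite !mulr_ge0.
apply: le_trans (coalescence V0 unifF degF b0 HS HO sO rO) _.
rewrite -[leRHS]mulrA ler_wpM2l ?(ltW n0) //.
have := mono 1; rewrite mul1r => h1.
apply: le_trans (_ : z + K * z * fS + Delta%:R * (K * z * fO 1%N) <= _).
  by rewrite !lerD2r; apply: h1 => //; apply: le_trans l1.
by rewrite le_eqVlt; apply/orP; left; apply/eqP; ring.
Qed.

End Rate.

Section Mixing.
Variable R : realType.

(** The exponent p is chosen with 4 A < 2^p <= n^p, and m >= 16 (p + 1) n ln n
    makes the decay factor at most n^(-(p + 1)). *)
Lemma mixing_of_coalescence (A : R) : 0 <= A -> exists C : R,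
  forall (V : finType) (F : {set {set V}}), (2 <= #|V|)%N ->
  (forall m (s r : config V), s \in Omega F -> r \in Omega F ->
     expect (m + m) (fun L => (glauber_run F s L != glauber_run F r L)%:R) <=
     #|V|%:R * A * (1 - 16^-1 / #|V|%:R) ^+ m) ->
  (mixing_time F R <= (C * #|V|%:R * ln #|V|%:R)%:E)%E.
Proof.
move=> A0; pose p := (Num.truncn (4 * A)).+1.
have pA : 4 * A < 2 ^+ p.
  apply: lt_trans (truncnS_gt _) _; rewrite -/p -natrX ltr_nat; exact: ltn_expl.
pose C1 : R := 16 * p.+1%:R.
exists (2 * C1 + (ln 2)^-1) => V F n2 H.
set n : R := #|V|%:R.
have n0 : 0 < n by rewrite ltr0n; apply: leq_trans n2.
have V0 : (0 < #|V|)%N by apply: leq_trans n2.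
have n2R : 2 <= n by rewrite (ler_nat _ 2).
have l2 : 0 < ln 2 :> R by rewrite ln_gt0 // ltr1n.
have ln2 : ln 2 <= ln n by rewrite ler_ln // posrE.
have lnn : 0 < ln n by apply: lt_le_trans ln2.
pose m := (Num.truncn (C1 * n * ln n)).+1.
have m1 : C1 * n * ln n <= m%:R by apply: ltW; exact: truncnS_gt.
have C10 : 0 < C1 by rewrite mulr_gt0 // ltr0n.
have m2 : m%:R <= C1 * n * ln n + 1.
  rewrite /m -natr1 lerD2r; have /truncn_itv/andP[] // : 0 <= C1 * n * ln n.
  by rewrite !mulr_ge0 // ltW.
have decay : (1 - 16^-1 / n) ^+ m <= (n ^+ p.+1)^-1.
  have x0 : 0 <= 1 - 16^-1 / n.
    rewrite subr_ge0 ler_pdivrMr // mul1r; apply: le_trans n2R.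
    by rewrite invf_ple ?posrE // ; lra.
  apply: le_trans (_ : expR (- (16^-1 / n)) ^+ m <= _).
    by rewrite lerXn2r ?nnegrE ?expR_ge0 // expR_ge1Dx.
  rewrite -expRM_natl mulrN expRN lef_pV2 ?posrE ?expR_gt0 ?exprn_gt0 //.
  rewrite -[leLHS]lnK ?posrE ?exprn_gt0 // ler_expR lnXn //.
  rewrite mulrA ler_pdivlMr // -[ln n *+ _]mulr_natl.
  apply: le_trans (ler_wpM2r _ m1); last by rewrite invr_ge0.
  by rewrite le_eqVlt; apply/orP; left; apply/eqP; rewrite /C1; field.
have small : n * A * (1 - 16^-1 / n) ^+ m < 4^-1.
  apply: le_lt_trans (_ : n * A * (n ^+ p.+1)^-1 < _).
    by rewrite ler_wpM2l // mulr_ge0 // ltW.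
  rewrite exprS invfM mulrACA mulfV ?gt_eqF // mul1r ltr_pdivrMr ?exprn_gt0 //.
  rewrite -ltr_pdivrMl ?invr_gt0 // invrK; apply: lt_le_trans pA _.
  by rewrite lerXn2r ?nnegrE // ltW.
apply: le_trans (_ : ((m + m)%:R%:E <= _)%E); last first.
  rewrite lee_fin natrD.
  have e1 : 1 <= (ln 2)^-1 * ln n by rewrite ler_pdivlMl // mulr1.
  have e2 : 2 <= (ln 2)^-1 * n * ln n.
    rewrite mulrAC mulrC; apply: le_trans n2R _.
    by rewrite ler_peMr // ltW.
  rewrite [leRHS](_ : _ = 2 * (C1 * n * ln n) + (ln 2)^-1 * n * ln n); last by ring.
  move: m2 e2; clearbody m C1.
  by move: (C1 * n * ln n) ((ln 2)^-1 * n * ln n) (m%:R : R) => a1 a2 a3; lra.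
apply: ereal_inf_lbound; exists (m + m)%N => //=.
rewrite /worst_tv_dist; apply: bigmax_lt; first by rewrite invr_gt0.
move=> s sO; apply: le_lt_trans small.
apply: tv_dist_le => // r rO; exact: H.
Qed.

End Mixing.

Section Regimes.
Variable R : realType.

Lemma bernoulli (d : R) n : 0 <= d -> 1 + n%:R * d <= (1 + d) ^+ n.
Proof.
move=> d0; elim: n => [|n IH]; first by rewrite mul0r addr0.
rewrite exprS; apply: le_trans (_ : (1 + d) * (1 + n%:R * d) <= _).
  have : 0 <= n%:R * d * d by rewrite !mulr_ge0.
  by rewrite -natr1; set t := n%:R; lra.
by rewrite ler_wpM2l // addr_ge0.
Qed.

(** Bernoulli's inequality for the d-th root of y. *)
Lemma polynomial_below_exponential (y : R) d : 1 < y -> (0 < d)%N ->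
  exists2 K, 1 <= K & forall n : nat, n.+1%:R ^+ d <= K * y ^+ n.
Proof.
move=> y1 d0; pose e := y `^ d%:R^-1 - 1.
have y0 : 0 < y by apply: lt_trans y1.
have dR : (d%:R : R) != 0 by rewrite pnatr_eq0 -lt0n.
have e0 : 0 < e.
  have one : 1 `^ d%:R^-1 = 1 :> R by rewrite powR1.
  rewrite /e subr_gt0 -[ltLHS]one gt0_ltr_powR ?nnegrE ?(ltW y0) //.
  by rewrite invr_gt0 ltr0n.
have ye : y = (1 + e) ^+ d.
  by rewrite /e addrC subrK -powR_mulrn ?powR_ge0 // -powRrM mulVf // powRr1 // ltW.
exists ((1 + e^-1) ^+ d).
  by apply: exprn_ege1; rewrite lerDl invr_ge0 ltW.
move=> n; rewrite ye -exprM mulnC exprM -exprMn lerXn2r ?nnegrE //.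
  by rewrite mulr_ge0 ?exprn_ge0 // addr_ge0 ?invr_ge0 // ltW.
apply: le_trans (ler_wpM2l _ (bernoulli n (ltW e0))); last first.
  by rewrite addr_ge0 ?invr_ge0 ?ltW.
have e1 : e^-1 * e = 1 by rewrite mulVf // gt_eqF.
have h1 : 0 < e^-1 by rewrite invr_gt0.
rewrite -natr1 (_ : (1 + e^-1) * _ = 1 + e^-1 + n%:R * e + n%:R * (e^-1 * e)); last by ring.
rewrite e1 mulr1; have : 0 <= n%:R * e by rewrite mulr_ge0 // ltW.
set t := n%:R; set z := t * e; lra.
Qed.

End Regimes.

(** * The two regimes *)

Section MainRegimes.
Variable R : realType.
Variables (V : finType) (F : {set {set V}}) (k Delta : nat).
Hypothesis V0 : (0 < #|V|)%N.
Hypothesis k1 : (0 < k)%N.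
Hypothesis unifF : forall B, B \in F -> #|B| = k.
Hypothesis degF : forall v, (degree F v <= Delta)%N.
Variable c : R.
Hypotheses (c0 : 0 < c) (c1 : c <= 1).

(** The smallest potentials are those of a survivor, c, and of a detour witness,
    (7/8) k^(-3), whence the constant c^-1 + 2 k^3. *)
Lemma general_rate (y K eps : R) m (s r : config V) :
  0 < eps -> 64 * eps <= 1 -> 1 <= y -> y ^+ 8 = 2 -> 1 <= K ->
  (forall n : nat, n.+1%:R ^+ 7 <= K * y ^+ n) ->
  c * K = eps -> Delta%:R <= c * y ^+ (4 * k) ->
  s \in Omega F -> r \in Omega F ->
  expect (m + m) (fun L => (glauber_run F s L != glauber_run F r L)%:R) <=
  #|V|%:R * (1 + (c^-1 + 2 * k%:R ^+ 3) * (c + Delta%:R * overlap_weight y 1)) *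
    (1 - 16^-1 / #|V|%:R) ^+ m.
Proof.
move=> e0 e64 y1 y8 K1 polyK cK smallD sO rO.
pose fW := witness_weight y k; pose fD : R := detour_weight R k.
have y0 : 0 < y := lt_le_trans ltr01 y1.
have kR : 0 < k%:R :> R by rewrite ltr0n.
have k3 : 0 < k%:R ^+ 3 :> R by rewrite exprn_gt0.
have W0 : 0 < fW by exact: witness_weight_gt0.
have D0 : 0 < fD by exact: detour_weight_gt0.
have Kp0 : 0 <= c^-1 + 2 * k%:R ^+ 3.
  by rewrite addr_ge0 ?invr_ge0 ?(ltW c0) // mulr_ge0 // ltW.
apply: (@coalescence_rate _ _ _ k (small_overlap k) Delta V0 unifF degF
  (overlap_weight y) fW fD ((1 - 8^-1) * fD) c 8^-1) => //.
- exact: ltW.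
- exact: overlap_weight_ge0.
- by apply/andP; split; lra.
move=> m' Z st rel; apply: explores_bound => //.
- exact: overlap_weight_ge0.
- exact: ltW.
- exact: ltW.
- by rewrite mulr_ge0 ?(ltW D0) //; lra.
- exact: ltW.
- by apply/andP; split; lra.
- by move=> q; exact: overlap_weight_decr.
- by move=> A Q; apply: (cost_overlap e0 e64 y1 y8 K1 polyK unifF degF k1 c0 cK smallD).
- by move=> A Q _; apply: (cost_witness e0 e64 y1 y8 K1 polyK unifF degF k1 c0 cK smallD).
- by move=> A _; apply: (cost_detour e64 y1 y8 K1 polyK unifF degF k1 c0 cK smallD).
have ci : 1 <= c^-1 by rewrite invf_ge1.
have big (x : R) : 1 <= x -> 1 <= (c^-1 + 2 * k%:R ^+ 3) * x.
  move=> x1; apply: mulr_ege1 => //; apply: le_trans ci _.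
  by rewrite lerDl mulr_ge0 // ltW.
have bigD (x : R) : 2^-1 <= x -> 1 <= (c^-1 + 2 * k%:R ^+ 3) * (x * fD).
  move=> x1; rewrite mulrDl -[leLHS]add0r; apply: lerD.
    by rewrite !mulr_ge0 ?invr_ge0 ?(ltW c0) ?(ltW D0) // (le_trans _ x1).
  rewrite /fD /detour_weight (_ : 2 * _ * _ = 2 * x); last by field; rewrite gt_eqF.
  by lra.
case=> [A Q|w A|u w A|w A|u] /=.
- case/andP=> _; rewrite -card_gt0 => q0; apply: big.
  by case: #|Q| q0 => //= q _; rewrite exprn_ege1.
- move=> _; apply: big; rewrite /fW /witness_weight mulr_ege1 // exprn_ege1 //.
  by rewrite ler1n.
- by move=> _; rewrite -[fD]mul1r; apply: bigD; lra.
- by move=> _; apply: bigD; lra.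
- move=> _; rewrite mulrDl mulVf ?gt_eqF // lerDl.
  by rewrite mulr_ge0 ?(ltW c0) // mulr_ge0 // ltW.
Qed.

Lemma linear_rate m (s r : config V) :
  (forall A B, A \in F -> B \in F -> A != B -> (#|A :&: B| <= 1)%N) ->
  512 * c <= 1 -> Delta%:R * (k%:R ^+ 2 * 2^-1 ^+ k) <= c ->
  s \in Omega F -> r \in Omega F ->
  expect (m + m) (fun L => (glauber_run F s L != glauber_run F r L)%:R) <=
  #|V|%:R * (1 + c^-1 * (c + Delta%:R * linear_weight R 1)) * (1 - 16^-1 / #|V|%:R) ^+ m.
Proof.
move=> linF c512 smallD sO rO.
apply: (@coalescence_rate _ _ _ k 0 Delta V0 unifF degF (@linear_weight R) 0 0 0 c 16^-1) => //.
- by rewrite invr_ge0 ltW.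
- exact: ltW.
- exact: linear_weight_ge0.
- by apply/andP; split; lra.
move=> m' Z st rel; apply: explores_bound => //.
- exact: linear_weight_ge0.
- exact: ltW.
- by apply/andP; split; lra.
- case=> [|q]; first by rewrite mul0r mulr0.
  have g0 := linear_growth_gt0 R q.+1.
  have := linear_weight_gain R (ltn0Sn q); rewrite [linear_weight R q.+1]/=.
  have z0 : (0 : R) < 2 ^+ q.+1 by rewrite exprn_gt0.
  have lg : linear_growth R q.+1 <= 1 + q.+1%:R / 2 + 2 ^+ q.+1 / 24.
    rewrite /linear_growth lerD2l ler_pM2l // lef_pV2 ?posrE ?mulr_gt0 ?ltr0n ?addn2 //.
    by rewrite -natrM ler_nat; nat_lia.
  have : (1 : R) <= q.+1%:R by rewrite ler1n.
  move: lg z0; move: (2 ^+ q.+1) (linear_growth R q.+1) (linear_weight R q) (q.+1%:R : R).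
  by move=> z g w x; lra.
- by move=> A Q; apply: linear_supersolution.
- by rewrite invr_ge0 ltW.
case=> [A Q|w A|u w A|w A|u] /=; rewrite ?andbF //; last by rewrite mulVf // gt_eqF.
case/andP=> _; rewrite -card_gt0 => q0; apply: mulr_ege1; first by rewrite invf_ge1.
case: #|Q| q0 => //= q _; rewrite /linear_growth -addrA lerDl addr_ge0 //.
Qed.

End MainRegimes.

Theorem theorem1p1 (R : realType) :
  exists c : R, 0 < c /\
    forall k Delta : nat, (1 <= k)%N ->
    exists C : R,
      forall (n : nat) (V : finType) (F : {set {set V}}),
        (2 <= n)%N -> #|V| = n ->
        uniform_hypergraph F k -> max_degree F = Delta ->
        (Delta%:R <= c * 2 `^ (k%:R / 2)
         \/ (Delta%:R <= c * (2 ^+ k / k%:R ^+ 2) /\ linear_hypergraph F)) ->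
        (mixing_time F R <= (C * n%:R * ln n%:R)%:E)%E.
Proof.
pose y : R := 2 `^ 8^-1.
have y0 : 0 <= y by exact: powR_ge0.
have y8 : y ^+ 8 = 2.
  by rewrite -powR_mulrn // -powRrM mulVf // powRr1.
have y1 : 1 < y.
  rewrite ltNge; apply/negP => y1; have := exprn_ile1 8 y0 y1; rewrite y8.
  by lra.
have [K K1 polyK] := polynomial_below_exponential y1 (isT : 0 < 7)%N.
have K0 : 0 < K by apply: lt_le_trans K1.
have [eps e0 e1] : exists2 e : R, 0 < e & 512 * e <= 1 by exists 512^-1; lra.
(* The constants of both supersolutions are absorbed by K and eps. *)
pose c := eps / K.
have c0 : 0 < c by rewrite divr_gt0.
have cK : c * K = eps by rewrite divfK // gt_eqF.
have ce : c <= eps by rewrite -cK ler_peMr // ltW.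
exists c; split=> // k Delta k1.
pose Ag := 1 + (c^-1 + 2 * k%:R ^+ 3) * (c + Delta%:R * overlap_weight y 1).
pose Al := 1 + c^-1 * (c + Delta%:R * linear_weight R 1).
have ci : 0 <= c^-1 by rewrite invr_ge0 ltW.
have Ag0 : 0 <= Ag.
  rewrite addr_ge0 // mulr_ge0 // addr_ge0 ?(ltW c0) // mulr_ge0 //.
  exact: overlap_weight_ge0 (ltW y1) _.
have Al0 : 0 <= Al.
  rewrite addr_ge0 // mulr_ge0 // addr_ge0 ?(ltW c0) // mulr_ge0 //.
  exact: linear_weight_ge0.
have [C HC] := mixing_of_coalescence (addr_ge0 Ag0 Al0).
exists C => n V F + eV; rewrite -eV => n2 uni maxD regime.
have V0 : (0 < #|V|)%N by exact: ltnW.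
have unifF B : B \in F -> #|B| = k.
  by move=> BF; have /forallP/(_ B) := uni; rewrite BF => /eqP.
have degF v : (degree F v <= Delta)%N by rewrite -maxD; exact: leq_bigmax.
have n0 : 0 < #|V|%:R :> R by rewrite ltr0n.
have z0 m : 0 <= (1 - 16^-1 / #|V|%:R : R) ^+ m.
  rewrite exprn_ge0 // subr_ge0 ler_pdivrMr // mul1r.
  have : 1 <= #|V|%:R :> R by rewrite ler1n.
  by lra.
have c1 : c <= 1 by lra.
apply: HC => // m s r sO rO.
case: regime => [smallD|[smallD linF]].
  have smallD' : Delta%:R <= c * y ^+ (4 * k).
    rewrite -powR_mulrn // -powRrM (_ : 8^-1 * _ = k%:R / 2) //.
    by rewrite natrM; field.
  have e64 : 64 * eps <= 1 by lra.
  have := general_rate V0 k1 unifF degF c0 c1 m e0 e64 (ltW y1) y8 K1 polyK cK smallD' sO rO.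
  move=> h; apply: le_trans h _.
  by rewrite ler_wpM2r // ler_pM2l // lerDl.
have smallD' : Delta%:R * (k%:R ^+ 2 * 2^-1 ^+ k) <= c.
  have p1 : 0 < (k%:R : R) ^+ 2 by rewrite exprn_gt0 // ltr0n.
  have p2 : 0 < (2 : R) ^+ k by rewrite exprn_gt0.
  rewrite -ler_pdivlMr ?mulr_gt0 ?exprn_gt0 ?invr_gt0 ?ltr0n //.
  by rewrite exprVn invfM invrK [_^-1 * _]mulrC.
have linF' B1 B2 : B1 \in F -> B2 \in F -> B1 != B2 -> (#|B1 :&: B2| <= 1)%N.
  move=> h1 h2 h3; have /forallP/(_ B1)/forallP/(_ B2) := linF.
  by rewrite h1 h2 h3.
have c512 : 512 * c <= 1 by lra.
have h := linear_rate V0 k1 unifF degF c0 c1 m linF' c512 smallD' sO rO.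
apply: le_trans h _.
by rewrite ler_wpM2r // ler_pM2l // lerDr.
Qed.
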